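(* Let $E=\mathbb{Q}(\sqrt{-3})$ and let $\mathfrak{O}=\mathbb{Z}\left[\frac{1+\sqrt{-3}}{2}\right]$ be its ring of integers. A positive Hermitian $\mathfrak{O}$-lattice is $2$-universal if it represents $\langle 1,1\rangle$ and $\langle 1,2\rangle$.
   Context: A Hermitian $\mathfrak{O}$-lattice is a finitely generated $\mathfrak{O}$-submodule $L$ of a finite-dimensional $E$-vector space equipped with a form $H$ that is linear in the first variable, satisfies $H(x,y)=\overline{H(y,x)}$ (bar is complex conjugation), and has $H(L,L)\subseteq\mathfrak{O}$. Its rank is $\dim_E EL$; binary means rank 2. It is positive (definite) if $H(v):=H(v,v)>0$ for all $0\neq v\in L$. Here every lattice is free ($\mathfrak{O}$ is a PID); the Gram matrix of a lattice with basis $v_1,\dots,v_n$ is $M_L=(H(v_i,v_j))$. $\langle a_1,\dots,a_n\rangle$ denotes the lattice with diagonal Gram matrix with entries $a_1,\dots,a_n$. $L$ represents $\ell$ if $M_\ell=XM_LX^*$ for some matrix $X$ over $\mathfrak{O}$, where $X^*$ is the conjugate transpose. A positive Hermitian $\mathfrak{O}$-lattice is $2$-universal if it represents all binary positive Hermitian $\mathfrak{O}$-lattices. *)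

(* Defs.v *)
From HB Require Import structures.
From mathcomp Require Import all_boot all_order all_algebra all_field.
From mathcomp Require Import boolp ring.

Set Implicit Arguments.
Unset Strict Implicit.
Unset Printing Implicit Defensive.

Import Order.TTheory GRing.Theory Num.Theory.

Local Open Scope ring_scope.
Local Open Scope sesquilinear_scope.

Definition in_Qsqrtm3 : {pred algC} :=
  [pred x | `[< exists a b : rat, x = ratr a + ratr b * sqrtC (- 3) >]].

Lemma in_Qsqrtm3P (x : algC) :
  reflect (exists a b : rat, x = ratr a + ratr b * sqrtC (- 3))
          (x \in in_Qsqrtm3).
Proof. exact: asboolP. Qed.

Lemma conj_sqrtCm3 : (sqrtC (- 3 : algC))^* = - sqrtC (- 3).
Proof.
set s := sqrtC _.
have s2 : s ^+ 2 = - 3 by rewrite sqrtCK.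
have : (s^*) ^+ 2 == s ^+ 2 by rewrite -rmorphXn /= s2 rmorphN /= rmorph_nat.
rewrite eqf_sqr => /orP[/eqP/CrealP sR|/eqP //].
have : 0 <= s ^+ 2 by rewrite real_exprn_even_ge0.
by rewrite s2 oppr_ge0 lern0.
Qed.

Lemma conj_ratr (a : rat) : (ratr a : algC)^* = ratr a.
Proof. exact: fmorph_rat. Qed.

Lemma conj_coord (a b : rat) :
  (ratr a + ratr b * sqrtC (- 3) : algC)^* = ratr a - ratr b * sqrtC (- 3).
Proof.
by rewrite rmorphD [X in _ + X]rmorphM /= !conj_ratr conj_sqrtCm3 mulrN.
Qed.

Lemma in_Qsqrtm3_conj (x : algC) : x \in in_Qsqrtm3 -> x^* \in in_Qsqrtm3.
Proof.
case/in_Qsqrtm3P => a [b ->]; apply/in_Qsqrtm3P; exists a, (- b).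
by rewrite conj_coord rmorphN mulNr.
Qed.

Lemma in_Qsqrtm3_divring_closed : divring_closed in_Qsqrtm3.
Proof.
have mulC (x y : algC) : x \in in_Qsqrtm3 -> y \in in_Qsqrtm3 ->
    x * y \in in_Qsqrtm3.
  case/in_Qsqrtm3P => a [b ->] /in_Qsqrtm3P[c [d ->]].
  apply/in_Qsqrtm3P; exists (a * c - 3 * (b * d)), (a * d + b * c).
  rewrite rmorphB rmorphD !(rmorphM (ratr : {rmorphism rat -> algC})) /= ratr_nat.
  have := sqrtCK (- 3 : algC); set s := sqrtC _ => s2.
  set A := ratr a; set B := ratr b; set C := ratr c; set D := ratr d.
  have -> : (A + B * s) * (C + D * s) =
    A * C + s ^+ 2 * (B * D) + (A * D + B * C) * s by ring.
  by rewrite s2 mulNr.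
have divC (x y : algC) : x \in in_Qsqrtm3 -> y \in in_Qsqrtm3 ->
    x / y \in in_Qsqrtm3.
  move=> xE yE; apply: (mulC) => //.
  have -> : y^-1 = y^* * (y * y^*)^-1.
    have [->|y0] := eqVneq y 0; first by rewrite mul0r invr0 mulr0.
    by rewrite invfM mulrCA mulfV ?mulr1 // fmorph_eq0.
  apply: (mulC); first exact: in_Qsqrtm3_conj.
  case/in_Qsqrtm3P: yE => a [b ->].
  apply/in_Qsqrtm3P; exists (a ^+ 2 + 3 * b ^+ 2)^-1, 0.
  rewrite rmorph0 mul0r addr0 fmorphV; congr (_^-1).
  rewrite conj_coord (rmorphD (ratr : {rmorphism rat -> algC})).
  rewrite [X in _ = _ + X](rmorphM (ratr : {rmorphism rat -> algC})) /=.
  rewrite ratr_nat !rmorphXn /=.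
  have := sqrtCK (- 3 : algC); set s := sqrtC _ => s2.
  have -> : (ratr a + ratr b * s) * (ratr a - ratr b * s) =
    ratr a ^+ 2 - s ^+ 2 * ratr b ^+ 2 by ring.
  by rewrite s2 mulNr opprK.
split=> [|x y|x y].
- apply/in_Qsqrtm3P; exists 1, 0.
  by rewrite rmorph1 rmorph0 mul0r addr0.
- case/in_Qsqrtm3P => a [b ->] /in_Qsqrtm3P[c [d ->]].
  apply/in_Qsqrtm3P; exists (a - c), (b - d).
  rewrite !(rmorphB (ratr : {rmorphism rat -> algC})) /=; ring.
exact: divC.
Qed.

HB.instance Definition _ :=
  GRing.isDivringClosed.Build algC in_Qsqrtm3 in_Qsqrtm3_divring_closed.

(* The field E = Q(sqrt(-3)), as a subfield of the complex algebraic numbers. *)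
Record Qsqrtm3 := in_Qsqrtm3_sub {
  Qsqrtm3_val :> algC;
  Qsqrtm3_valP : Qsqrtm3_val \in in_Qsqrtm3 }.

HB.instance Definition _ := [isSub for Qsqrtm3_val].
HB.instance Definition _ := [Countable of Qsqrtm3 by <:].
HB.instance Definition _ := [SubChoice_isSubIntegralDomain of Qsqrtm3 by <:].
HB.instance Definition _ := [SubIntegralDomain_isSubField of Qsqrtm3 by <:].

Definition conjE (x : Qsqrtm3) : Qsqrtm3 :=
  in_Qsqrtm3_sub (in_Qsqrtm3_conj (Qsqrtm3_valP x)).

Lemma conjE_is_zmod_morphism : zmod_morphism conjE.
Proof. by move=> x y; apply/val_inj; rewrite /= rmorphB. Qed.

Lemma conjE_is_monoid_morphism : monoid_morphism conjE.
Proof. by split=> [|x y]; apply/val_inj; rewrite /= (rmorph1, rmorphM). Qed.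

HB.instance Definition _ :=
  GRing.isZmodMorphism.Build Qsqrtm3 Qsqrtm3 conjE conjE_is_zmod_morphism.
HB.instance Definition _ :=
  GRing.isMonoidMorphism.Build Qsqrtm3 Qsqrtm3 conjE conjE_is_monoid_morphism.

Lemma conjEK : involutive conjE.
Proof. by move=> x; apply/val_inj; rewrite /= conjCK. Qed.

HB.instance Definition _ := isInvolutive.Build Qsqrtm3 conjE conjEK.

Lemma omega_subproof : (1 + sqrtC (- 3)) / 2 \in in_Qsqrtm3.
Proof.
apply/in_Qsqrtm3P; exists (1 / 2), (1 / 2).
rewrite (rmorphM (ratr : {rmorphism rat -> algC})) fmorphV /= ratr_nat.
by rewrite rmorph1 mulrDl [_ * sqrtC _]mulrC !mul1r.
Qed.

Definition omega : Qsqrtm3 := in_Qsqrtm3_sub omega_subproof.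

(* O = Z[omega] = Z + Z omega. *)
Definition OE : {pred Qsqrtm3} :=
  [pred x | `[< exists m n : int, x = m%:~R + n%:~R * omega >]].

Lemma OEP (x : Qsqrtm3) :
  reflect (exists m n : int, x = m%:~R + n%:~R * omega) (x \in OE).
Proof. exact: asboolP. Qed.

Lemma omega_sqr : omega ^+ 2 = omega - 1.
Proof.
rewrite expr2; apply/val_inj => /=.
have := sqrtCK (- 3 : algC); move: (sqrtC _) => s s2.
have -> : (1 + s) / 2 * ((1 + s) / 2) = (1 + 2 * s + s ^+ 2) / 4 by field.
by rewrite s2; field.
Qed.

Lemma OE_subring_closed : subring_closed OE.
Proof.
split=> [|x y|x y].
- by apply/OEP; exists 1, 0; rewrite mul0r addr0.
- case/OEP => m [n ->] /OEP[p [q ->]]; apply/OEP; exists (m - p), (n - q).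
  by rewrite !rmorphB /= mulrBl opprD addrACA.
case/OEP => m [n ->] /OEP[p [q ->]]; apply/OEP.
exists (m * p - n * q), (m * q + n * p + n * q).
rewrite !(rmorphD, rmorphN, rmorphM) /=.
have := omega_sqr; move: omega => w w2.
rewrite mulrDl !mulrDr (mulrACA _ w _ w) -expr2 w2; ring.
Qed.

HB.instance Definition _ :=
  GRing.isSubringClosed.Build Qsqrtm3 OE OE_subring_closed.

Lemma conjE_omega : conjE omega = 1 - omega.
Proof.
apply/val_inj; rewrite /= rmorphM fmorphV rmorphD /= conj_sqrtCm3.
rewrite rmorph1 rmorph_nat.
have n2 : 2 != 0 :> algC by rewrite pnatr_eq0.
by apply: (mulIf n2); rewrite divfK // mulrBl divfK // mul1r; ring.
Qed.

Lemma OE_conj (x : Qsqrtm3) : x \in OE -> conjE x \in OE.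
Proof.
case/OEP => m [n ->]; apply/OEP; exists (m + n), (- n).
rewrite !rmorphD !rmorphM /= conjE_omega !rmorph_int rmorphN /=; ring.
Qed.

Definition in_Ospan (V : vectType Qsqrtm3) (s : seq V) (v : V) : Prop :=
  exists c : nat -> Qsqrtm3,
    (forall i, c i \in OE) /\ v = \sum_(i < size s) c i *: s`_i.

(* The lattice is the O-submodule of hl_space generated by hl_gens, which need
   be neither O-independent nor spanning for hl_space. *)
Record hermLattice := HermLattice {
  hl_space : vectType Qsqrtm3;
  hl_form : {hermitian hl_space for false & conjE};
  hl_gens : seq hl_space;
  hl_integral : forall x y : hl_space, in_Ospan hl_gens x ->
    in_Ospan hl_gens y -> hl_form x y \in OE }.

Definition in_lattice (L : hermLattice) (v : hl_space L) : Prop :=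
  in_Ospan (hl_gens L) v.

Definition rank (L : hermLattice) : nat := \dim <<hl_gens L>>.

(* The order is that of algC, in which 0 < z forces z to be real. *)
Definition positive (L : hermLattice) : Prop :=
  forall v : hl_space L, in_lattice v -> v != 0 ->
    0 < Qsqrtm3_val (hl_form L v v).

Definition is_basis (L : hermLattice) n (b : n.-tuple (hl_space L)) : Prop :=
  free b /\ forall v : hl_space L, in_lattice v <-> in_Ospan b v.

Definition gram (L : hermLattice) n (b : n.-tuple (hl_space L)) :
  'M[Qsqrtm3]_n := \matrix_(i, j) hl_form L (tnth b i) (tnth b j).

Definition represents (L l : hermLattice) : Prop :=
  exists n (b : n.-tuple (hl_space L)) m (c : m.-tuple (hl_space l))
    (X : 'M[Qsqrtm3]_(m, n)),
    [/\ is_basis b, is_basis c, X \is a mxOver OE &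
        gram c = X *m gram b *m X ^t conjE].

Definition two_universal (L : hermLattice) : Prop :=
  positive L /\
  forall l : hermLattice, positive l -> rank l = 2%N -> represents L l.

Section DiagLattice.
Variable a : seq int.

Definition diag_gram : 'M[Qsqrtm3]_(size a) :=
  diag_mx (\row_i (a`_i)%:~R).

Lemma diag_gram_herm : diag_gram \is hermitianmx _ false conjE.
Proof.
apply/is_hermitianmxP; rewrite expr0 scale1r /diag_gram tr_diag_mx.
by rewrite map_diag_mx; congr diag_mx; apply/rowP => i; rewrite !mxE rmorph_int.
Qed.

Definition diag_herm : hermitian_matrix (size a) false conjE := HermitianMx diag_gram_herm.

Definition diag_form : {hermitian 'rV[Qsqrtm3]_(size a) for false & conjE} :=
  form_of_matrix conjE diag_herm.

Definition std_basis : seq 'rV[Qsqrtm3]_(size a) :=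
  [seq 'e_i | i <- enum 'I_(size a)].

Lemma in_Ospan_std_basis (v : 'rV[Qsqrtm3]_(size a)) i :
  in_Ospan std_basis v -> v 0 i \in OE.
Proof.
case=> c [cO ->]; rewrite summxE rpred_sum // => j _; rewrite mxE rpredM //.
have lt_j : (j < size (enum 'I_(size a)))%N.
  by rewrite -(size_map (fun i => 'e_i : 'rV[Qsqrtm3]__)) -/std_basis.
by rewrite (nth_map i) // mxE eqxx rpred_nat.
Qed.

Lemma diag_integral (x y : 'rV[Qsqrtm3]_(size a)) :
  in_Ospan std_basis x -> in_Ospan std_basis y -> diag_form x y \in OE.
Proof.
move=> xO yO; rewrite /= /form_of_matrix trace_mx11 mxE rpred_sum // => i _.
rewrite mul_mx_diag !mxE rpredM ?rpredM ?rpred_int ?OE_conj //;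
  exact: in_Ospan_std_basis.
Qed.

(* The lattice O^n with Gram matrix diag(a_1, ..., a_n) in the standard basis. *)
Definition diag_lattice : hermLattice := HermLattice diag_integral.

End DiagLattice.

Lemma size_std_basis a : size (std_basis a) == size a.
Proof. by rewrite size_map size_enum_ord. Qed.
Definition diag_basis a : (size a).-tuple (hl_space (diag_lattice a)) := Tuple (size_std_basis a).
Lemma tnth_diag_basis a (i : 'I_(size a)) : tnth (diag_basis a) i = 'e_i.
Proof.
rewrite (tnth_nth 0) /= (nth_map i) ?size_enum_ord //; congr delta_mx.
by apply/val_inj; rewrite /= nth_enum_ord.
Qed.
Lemma diag_basis_is_basis a : is_basis (diag_basis a).
Proof.
split=> //; apply/freeP => k /= /rowP E i.
have := E i; rewrite summxE (bigD1 i) //= big1 ?addr0 => [|j ji].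
  by rewrite mxE -(tnth_nth 0 (diag_basis a)) tnth_diag_basis mxE !eqxx mulr1 mxE.
by rewrite mxE -(tnth_nth 0 (diag_basis a)) tnth_diag_basis mxE eq_sym (negPf ji) andbF mulr0.
Qed.
Lemma gram_diag_basis a : gram (diag_basis a) = diag_gram a.
Proof.
apply/matrixP => i j; rewrite mxE !tnth_diag_basis.
by rewrite /= -[LHS]matrix_of_formE form_of_matrixK.
Qed.
Lemma rank_diag_lattice a : rank (diag_lattice a) = size a.
Proof.
rewrite /rank -[RHS](eqP (size_std_basis a)); apply/eqP; exact: (diag_basis_is_basis a).1.
Qed.

(* Main.v *)
Require Import Defs.
From mathcomp Require Import all_boot all_order all_algebra.
From mathcomp Require Import all_field boolp ring zify.

(** The theorem reduces to one representation statement, which is proved by an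
    explicit construction followed by reduction theory. Below, N is the norm of
    E over the rationals, and the discriminant of a binary form with diagonal a,
    b and off-diagonal entry x is a b - N(x).

    An orthonormal pair e1, e2 of L splits off over the integers. A second
    orthogonal pair v, w of norms 1 and 2 then forces a lattice vector f
    orthogonal to e1 and e2 with H(f) = D, where D is 1 or 2: either v has a
    nonzero component orthogonal to the pair, of norm 1, or v is a unit multiple
    of e1 or e2 and the component of w has norm 1 or 2, because 2 is not a norm
    (orthogonal_triple). So L contains <1, 1, D>, and it remains to show that
    <1, 1, D> represents every positive binary lattice l (binary_represented).
    This takes three steps.

    First, l may be replaced by any integral overlattice of the same rank. While
    the discriminant is divisible by a prime that is a norm, or by the square of
    an inert prime, there is a proper integral overlattice; so one may assume
    that the discriminant d of l is a product of distinct inert primes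
    (binary_maximal).

    Secondly, such an l embeds in a positive ternary lattice of determinant
    exactly D. Bordering the Gram matrix of l by a column (y, z) and a corner c
    gives the determinant c d - h(y, z), where h is the adjugate form of l, so
    all that is needed is a solution of h(y, z) = - D modulo d. Modulo an inert
    prime divisor of d the form h represents a unit times all norms, hence
    everything, since the norm of a finite field extension is onto; the
    solutions are combined by the Chinese remainder theorem
    (ternary_completion).

    Thirdly, a positive ternary form of determinant D at most 2 is represented
    by <1, 1, D> (tern_reduce). The Eisenstein integers have covering radius 1 /
    sqrt 3, so the first diagonal entry a of a Hermite-reduced form satisfies 8
    a ^ 3 <= 27 D, which forces a = 1; reduction of the projected binary form
    then makes its first entry 1 as well, and the triangular factorization is
    then integral.

    That l has a basis comes from positivity: two lattice vectors with the least
    positive Gram determinant generate l, since otherwise division with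
    remainder would produce a smaller determinant (lattice_pair_basis). *)

Set Implicit Arguments.
Unset Strict Implicit.
Unset Printing Implicit Defensive.

Import Order.TTheory GRing.Theory Num.Theory.

Local Open Scope ring_scope.
Local Open Scope sesquilinear_scope.
Local Notation E := Qsqrtm3.

(** * Norm and trace on the Eisenstein integers *)

Lemma val_intE (k : int) : Qsqrtm3_val k%:~R = k%:~R.
Proof. exact: (rmorph_int (val : {rmorphism E -> algC})). Qed.

Lemma intE_inj : injective (intr : int -> E).
Proof. by move=> m n /(congr1 Qsqrtm3_val); rewrite !val_intE => /intr_inj. Qed.

Lemma intE_eq0 (k : int) : (k%:~R == 0 :> E) = (k == 0).
Proof. exact: (inj_eq intE_inj k 0). Qed.

Definition toZ (x : E) : int := Num.floor (Qsqrtm3_val x).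

Lemma toZK (k : int) : toZ k%:~R = k.
Proof. by rewrite /toZ val_intE intrKfloor. Qed.

Definition normZ (x : E) : int := toZ (x * conjE x).

Definition traceZ (x : E) : int := toZ (x + conjE x).

Lemma conjE_coord (m n : int) :
  conjE (m%:~R + n%:~R * omega) = (m + n)%:~R - n%:~R * omega.
Proof.
have -> : conjE (m%:~R + n%:~R * omega) = m%:~R + n%:~R * conjE omega by ring.
by rewrite conjE_omega; ring.
Qed.

Lemma norm_coord (m n : int) (x := m%:~R + n%:~R * omega) :
  x * conjE x = (m ^+ 2 + m * n + n ^+ 2)%:~R.
Proof.
rewrite /x conjE_coord.
have -> : (m%:~R + n%:~R * omega) * ((m + n)%:~R - n%:~R * omega) =
  (m ^+ 2 + m * n)%:~R + n%:~R ^+ 2 * (omega - omega ^+ 2) by ring.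
by rewrite omega_sqr; ring.
Qed.

Lemma normZ_coord (m n : int) :
  normZ (m%:~R + n%:~R * omega) = m ^+ 2 + m * n + n ^+ 2.
Proof. by rewrite /normZ norm_coord toZK. Qed.

Lemma normZE x : x \in OE -> (normZ x)%:~R = x * conjE x.
Proof. by case/OEP=> m [n ->]; rewrite normZ_coord norm_coord. Qed.

Lemma traceZE x : x \in OE -> (traceZ x)%:~R = x + conjE x.
Proof.
case/OEP=> m [n ->]; rewrite /traceZ.
have -> : m%:~R + n%:~R * omega + conjE (m%:~R + n%:~R * omega) = (m + (m + n))%:~R.
  by rewrite conjE_coord; ring.
by rewrite toZK.
Qed.

Lemma omega_free (m n : int) : m%:~R + n%:~R * omega = 0 -> m = 0 /\ n = 0.
Proof.
move=> e; have := normZ_coord m n; rewrite e /normZ mul0r (toZK 0) => h; nia.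
Qed.

Lemma OE_real x : x \in OE -> conjE x = x -> x = (toZ x)%:~R.
Proof.
case/OEP=> m [n ->]; rewrite conjE_coord => e.
have /omega_free[n0 _] : n%:~R + (- n - n)%:~R * omega = 0.
  rewrite -[RHS](subrr (m%:~R + n%:~R * omega)) -[X in _ = X - _]e; ring.
by rewrite n0 mul0r addr0 toZK.
Qed.

Lemma normZ_int (k : int) : normZ k%:~R = k ^+ 2.
Proof. by have := normZ_coord k 0; rewrite mul0r addr0 => ->; ring. Qed.

Lemma normZ_ge0 x : x \in OE -> 0 <= normZ x.
Proof. by case/OEP=> m [n ->]; rewrite normZ_coord; nia. Qed.

Lemma normZ_eq0 x : x \in OE -> normZ x = 0 -> x = 0.
Proof.
case/OEP=> m [n ->]; rewrite normZ_coord => h.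
have [-> ->] : m = 0 /\ n = 0 by nia.
by rewrite mul0r addr0.
Qed.

Lemma normZM x y : x \in OE -> y \in OE -> normZ (x * y) = normZ x * normZ y.
Proof.
move=> xO yO; apply: intE_inj; rewrite rmorphM /= !normZE ?rpredM //; ring.
Qed.

Lemma normZ_conj x : normZ (conjE x) = normZ x.
Proof. by rewrite /normZ conjEK mulrC. Qed.

(** The congruence form of this expansion is what matters: shifting by a
    multiple of [k] changes the norm by a multiple of [k]. *)
Lemma normZD x y (k : int) : x \in OE -> y \in OE ->
  normZ (x + k%:~R * y) = normZ x + k * traceZ (x * conjE y) + k ^+ 2 * normZ y.
Proof.
move=> xO yO; apply: intE_inj; rewrite normZE ?rpredD ?rpredM ?rpred_int //.
transitivity ((normZ x)%:~R + k%:~R * (traceZ (x * conjE y))%:~R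
  + k%:~R ^+ 2 * (normZ y)%:~R : E); last by ring.
rewrite !normZE // traceZE ?rpredM ?OE_conj //.
rewrite !(rmorphD, rmorphM) /= rmorph_int conjEK; ring.
Qed.

(** The points 0, a and a omega span an equilateral triangle of side [a], and r
    + s omega lies in it. Its distances to the vertices, squared and weighted by
    its barycentric coordinates, average to a sum of products of those
    coordinates, which is at most a third of the squared side by the
    arithmetic-geometric inequality; so one vertex is within distance a / sqrt
    3. *)
Lemma hexagonal_covering (a r s : int) : 0 < a -> 0 <= r -> 0 <= s -> r + s <= a ->
  [\/ 3 * (r ^+ 2 + r * s + s ^+ 2) <= a ^+ 2,
      3 * ((r - a) ^+ 2 + (r - a) * s + s ^+ 2) <= a ^+ 2 |
      3 * (r ^+ 2 + r * (s - a) + (s - a) ^+ 2) <= a ^+ 2].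
Proof.
move=> a0 r0 s0 rs.
set A := r ^+ 2 + r * s + s ^+ 2; set B := (r - a) ^+ 2 + _ + _.
set C := r ^+ 2 + _ + _.
have bary : (a - r - s) * A + r * B + s * C
    = a * ((a - r - s) * r + (a - r - s) * s + r * s).
  by rewrite /A /B /C; ring.
have amgm : 3 * ((a - r - s) * r + (a - r - s) * s + r * s) <= a ^+ 2.
  by have := sqr_ge0 (a - r - s - r); have := sqr_ge0 (a - r - s - s);
     have := sqr_ge0 (r - s); lia.
have [|hA] := lerP (3 * A) (a ^+ 2); first by constructor 1.
have [|hB] := lerP (3 * B) (a ^+ 2); first by constructor 2.
have [|hC] := lerP (3 * C) (a ^+ 2); first by constructor 3.
exfalso; move: A B C bary hA hB hC => A B C bary hA hB hC.
have h1 : (a - r - s) * (a ^+ 2 + 1) <= (a - r - s) * (3 * A) by apply: ler_wpM2l; lia.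
have h2 : r * (a ^+ 2 + 1) <= r * (3 * B) by apply: ler_wpM2l; lia.
have h3 : s * (a ^+ 2 + 1) <= s * (3 * C) by apply: ler_wpM2l; lia.
have h4 : a * (a ^+ 2 + 1) <= a * (a ^+ 2).
  apply: le_trans (_ : a * (3 * ((a - r - s) * r + (a - r - s) * s + r * s)) <= _).
    by move: bary; lia.
  by apply: ler_wpM2l; lia.
move: h4 a0; rewrite mulrDr; lia.
Qed.

(** Euclidean division with the optimal constant 1/3, the squared covering
    radius of the hexagonal lattice. The weaker constant 3/4 given by rounding
    both coordinates would make Hermite's bound below too large for determinant
    2. *)
Lemma OE_div_int x (a : int) : 0 < a -> x \in OE ->
  exists2 q, q \in OE & 3 * normZ (x - a%:~R * q) <= a ^+ 2.
Proof.
move=> a0 /OEP[m [n ->]].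
have aN0 : a != 0 by lia.
have red u v : 3 * ((m - a * u) ^+ 2 + (m - a * u) * (n - a * v) + (n - a * v) ^+ 2)
    <= a ^+ 2 -> exists2 q, q \in OE &
      3 * normZ (m%:~R + n%:~R * omega - a%:~R * q) <= a ^+ 2.
  move=> h; exists (u%:~R + v%:~R * omega); first by apply/OEP; exists u, v.
  rewrite -normZ_coord in h.
  by congr (3 * normZ _ <= _): h; ring.
have := divz_eq m a; have := divz_eq n a.
have := modz_ge0 m aN0; have := modz_ge0 n aN0.
have := ltz_pmod m a0; have := ltz_pmod n a0.
move: (m %/ a)%Z (n %/ a)%Z (m %% a)%Z (n %% a)%Z => u v r s sa ra s0 r0 em en.
(* The diagonal from a to a omega cuts the fundamental parallelogram into two
   such triangles. *)
have [rs|rs] := lerP (r + s) a.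
  have [h|h|h] := hexagonal_covering a0 r0 s0 rs.
  - by apply: (red u v); move: h; congr (3 * _ <= _); rewrite em en; ring.
  - by apply: (red (u + 1) v); move: h; congr (3 * _ <= _); rewrite em en; ring.
  - by apply: (red u (v + 1)); move: h; congr (3 * _ <= _); rewrite em en; ring.
have [||| h|h|h] := @hexagonal_covering a (a - r) (a - s) a0; try lia.
- by apply: (red (u + 1) (v + 1)); move: h; congr (3 * _ <= _); rewrite em en; ring.
- by apply: (red u (v + 1)); move: h; congr (3 * _ <= _); rewrite em en; ring.
- by apply: (red (u + 1) v); move: h; congr (3 * _ <= _); rewrite em en; ring.
Qed.

(** * Split and inert rational primes *)

Definition dvdO (k : int) (x : E) := exists2 q, q \in OE & x = k%:~R * q.

Lemma dvdO_coord (k m n : int) :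
  dvdO k (m%:~R + n%:~R * omega) <-> (k %| m)%Z /\ (k %| n)%Z.
Proof.
split=> [[q /OEP[u [v ->]] e]|[/dvdzP[u ->] /dvdzP[v ->]]].
  have /omega_free[em en] : (m - k * u)%:~R + (n - k * v)%:~R * omega = 0.
    by rewrite -[RHS](subrr (m%:~R + n%:~R * omega)) [X in _ = _ - X]e; ring.
  by split; apply/dvdzP; [exists u | exists v]; lia.
exists (u%:~R + v%:~R * omega); first by apply/OEP; exists u, v.
ring.
Qed.

Lemma dvdO_coprime (k l : int) x : x \in OE -> coprimez k l ->
  dvdO k (l%:~R * x) -> dvdO k x.
Proof.
case/OEP=> m [n ->] kl.
have -> : l%:~R * (m%:~R + n%:~R * omega) =
  (l * m)%:~R + (l * n)%:~R * omega by ring.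
by case/dvdO_coord=> hm hn; apply/dvdO_coord;
  rewrite -(Gauss_dvdzr m kl) -(Gauss_dvdzr n kl).
Qed.

(** Fermat's descent for primes of the form m^2 + m n + n^2: reduce [x] modulo
    [k] to a [y] of norm [k * k'] with [k' < k]; then x times the conjugate of y
    is divisible by [k], and the quotient has norm [p * k']. *)
Lemma fermat_descent (p : nat) (k : nat) x : prime p -> (0 < k < p)%N ->
  x \in OE -> normZ x = (p * k)%N -> exists2 z, z \in OE & normZ z = p.
Proof.
move=> pp; elim/ltn_ind: k x => k IH x /andP[k0 kp] xO nx.
have [k1|k1] := leqP k 1.
  by exists x => //; rewrite nx (_ : k = 1%N) ?muln1 //; lia.
have [q qO hq] := @OE_div_int x k ltac:(lia) xO.
set y := x - k%:~R * q in hq.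
have yO : y \in OE by rewrite rpredB // rpredM ?rpred_int.
have ny : normZ y = normZ x + k%:Z * (k%:Z * normZ q - traceZ (x * conjE q)).
  have -> : y = x + (- k%:Z)%:~R * q by rewrite /y; ring.
  by rewrite normZD //; ring.
have [k' ny' ] : exists k', normZ y = k%:Z * k'.
  by eexists; rewrite ny nx PoszM mulrC -mulrDr.
have y0 := normZ_ge0 yO.
have k'k : k' < k by nia.
have [k'0|k'0] := lerP k' 0.
  have ny0 : normZ y = 0 by nia.
  have ex : x = k%:~R * q by move/eqP: (normZ_eq0 yO ny0); rewrite subr_eq0 => /eqP.
  have ep : p%:Z = k%:Z * normZ q.
    have := nx; rewrite ex normZM ?rpred_int // normZ_int PoszM => h.
    by have kN0 : k%:Z != 0 by [lia]; apply: (mulfI kN0);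
      rewrite mulrA -expr2 h mulrC.
  have : (k%:Z %| p%:Z)%Z by apply/dvdzP; exists (normZ q); rewrite ep mulrC.
  rewrite dvdzE /=.
  by case/primeP: pp => _ /(_ k) h /h /orP[]/eqP; lia.
have ezO : p%:Z%:~R - x * conjE q \in OE by rewrite rpredB ?rpred_int ?rpredM ?OE_conj.
have ez : k%:~R * (p%:Z%:~R - x * conjE q) = x * conjE y.
  transitivity ((p * k)%N%:Z%:~R - k%:~R * x * conjE q : E).
    by rewrite PoszM; ring.
  by rewrite -nx normZE // /y; ring.
have nz : normZ (p%:Z%:~R - x * conjE q) = p%:Z * k'.
  have := congr1 normZ ez; rewrite !normZM ?rpred_int ?OE_conj //.
  rewrite normZ_int normZ_conj nx ny' PoszM => h.
  have kN0 : k%:Z ^+ 2 != 0 by rewrite expf_eq0 /=; lia.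
  by apply: (mulfI kN0); rewrite h; ring.
case: k' k'0 k'k ny' nz => // k' k'0 k'k ny' nz.
by apply: (IH k' _ _ _ ezO); [lia | lia | rewrite nz PoszM].
Qed.

(** A witness against the second alternative, reduced modulo [p], has norm a
    positive multiple of [p] below [p ^ 2], from which the descent reaches [p]
    itself. *)
Lemma norm_or_inert (p : nat) : prime p ->
  (exists2 z, z \in OE & normZ z = p) \/
  (forall x, x \in OE -> (p %| normZ x)%Z -> dvdO p x).
Proof.
move=> pp; have p1 := prime_gt1 pp.
have [h|h] := pselect (exists2 z, z \in OE & normZ z = p); [by left | right].
move=> x xO /dvdzP[k nk]; apply: contrapT => ndv; apply: h.
have [q qO hq] := @OE_div_int x p ltac:(lia) xO.
set y := x - p%:~R * q in hq.
have yO : y \in OE by rewrite rpredB // rpredM ?rpred_int.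
have [l ny] : exists l, normZ y = p%:Z * l.
  exists (k - traceZ (x * conjE q) + p%:Z * normZ q).
  have -> : y = x + (- p%:Z)%:~R * q by rewrite /y; ring.
  by rewrite normZD // nk; ring.
have y0 : 0 < normZ y.
  rewrite lt_neqAle normZ_ge0 // andbT eq_sym; apply/eqP => /(normZ_eq0 yO) y0.
  by apply: ndv; exists q => //; apply/eqP; rewrite -subr_eq0 -/y y0.
have l0 : 0 < l by nia.
case: l l0 ny => // l l0 ny.
apply: (@fermat_descent p l y) => //; apply/andP; split; first by lia.
have : 3 * l%:Z <= p by rewrite -(@ler_pM2l _ p%:Z); lia.
by lia.
Qed.

Lemma dvdz_prime_mul (p : nat) (a b : int) : prime p -> (p %| a * b)%Z ->
  (p %| a)%Z \/ (p %| b)%Z.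
Proof.
by move=> pp; rewrite !dvdzE abszM /= Euclid_dvdM // => /orP[]; [left|right].
Qed.

(** An element of prime norm is prime. With z = e + f omega and b = m + n omega
    the combination n z - f b is a rational integer k, and the norm equation
    factors modulo p as k (k - n tr z) = 0; the two factors correspond to the
    two conjugate divisors. *)
Lemma split_prime (p : nat) z b : prime p -> z \in OE -> normZ z = p -> b \in OE ->
  (p %| normZ b)%Z -> exists2 q, q \in OE & b = z * q \/ b = conjE z * q.
Proof.
move=> pp zO nz bO pb; have p1 := prime_gt1 pp.
have zz := normZE zO; rewrite nz in zz.
have p0 : p%:Z%:~R != 0 :> E by rewrite intE_eq0; lia.
suff [[q qO e]|[q qO e]] : dvdO p (conjE z * b) \/ dvdO p (z * b).
- exists q => //; left; apply: (mulfI p0).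
  by rewrite mulrCA -e mulrA -zz.
- exists q => //; right; apply: (mulfI p0).
  by rewrite mulrCA -e mulrA [conjE z * z]mulrC -zz.
case/OEP: (zO) => e [f ez]; case/OEP: (bO) => m [n eb].
have fp : coprimez p f.
  rewrite coprimezE prime_coprime //; apply/negP => pf.
  have {}pf : (p %| f)%Z by [].
  have [f' ef] := dvdzP pf.
  have hp := nz; rewrite ez normZ_coord in hp.
  have h : (p %| e * e)%Z.
    by apply/dvdzP; exists (1 - e * f' - f' * f); lia.
  have {h} pe : (p %| e)%Z by case/(dvdz_prime_mul pp): h.
  have [e' ee] := dvdzP pe.
  have : p%:Z * (p%:Z * (e' ^+ 2 + e' * f' + f' ^+ 2)) = p%:Z * 1.
    by rewrite mulr1 -[RHS]hp ee ef; ring.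
  have pN0 : p%:Z != 0 by lia.
  move/(mulfI pN0); move: (_ + _) => S hS.
  have : (p %| 1)%Z by apply/dvdzP; exists S; rewrite mulrC.
  by rewrite dvdz1 absz_nat => /eqP; lia.
(* This k is n z - f b: the coefficients of omega cancel. *)
set k := n * e - f * m.
have ek : f%:~R * b = n%:~R * z - k%:~R by rewrite /k eb ez; ring.
have trz := traceZE zO.
have : (p %| k * (k - n * traceZ z))%Z.
  have -> : k * (k - n * traceZ z) = f ^+ 2 * normZ b - n ^+ 2 * p%:Z.
    apply: intE_inj.
    transitivity (f%:~R * b * conjE (f%:~R * b) - n%:~R ^+ 2 * p%:Z%:~R);
      last first.
      transitivity (f%:~R ^+ 2 * (b * conjE b) - n%:~R ^+ 2 * p%:Z%:~R);
        first by ring.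
      by rewrite -normZE //; ring.
    rewrite ek zz; transitivity (k%:~R * (k%:~R - n%:~R * (traceZ z)%:~R) : E);
      first by ring.
    by rewrite trz; ring.
  by rewrite rpredB // dvdz_mull // dvdz_mull.
case/dvdz_prime_mul => // /dvdzP[l el]; [left | right];
  (apply: (@dvdO_coprime p f); [by rewrite rpredM ?OE_conj | by [] | ]).
- exists (n%:~R - l%:~R * conjE z);
    first by rewrite rpredB ?rpredM ?OE_conj ?rpred_int.
  have -> : f%:~R * (conjE z * b) = conjE z * (f%:~R * b) by ring.
  rewrite ek el; transitivity (n%:~R * (z * conjE z) - l%:~R * p%:Z%:~R * conjE z).
    by ring.
  by rewrite -zz; ring.
- exists (- n%:~R - l%:~R * z).
    by rewrite rpredB ?rpredN ?rpredM ?rpred_int.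
  have -> : f%:~R * (z * b) = z * (f%:~R * b) by ring.
  have {}el : k = n * traceZ z + l * p%:Z by lia.
  rewrite ek el.
  transitivity (z * (n%:~R * z - n%:~R * (traceZ z)%:~R - l%:~R * p%:Z%:~R)).
    by ring.
  by rewrite trz zz; ring.
Qed.

(** * Norms modulo a prime *)

(** Every fibre of squaring lies in some [{v, - v}]. *)
Lemma card_squares_ge_half (F : finFieldType) : (#|F| <= 2 * #|[set u ^+ 2 | u : F]|)%N.
Proof.
rewrite -[#|F|]cardsT -sum1_card.
rewrite (partition_big (fun u : F => u ^+ 2) [in [set u ^+ 2 | u : F]]) /=;
  last first.
  by move=> u _; apply: imset_f.
rewrite mulnC -sum_nat_const; apply: leq_sum => a /imsetP[v _ ->].
rewrite sum1dep_card; apply: leq_trans (_ : #|[set v; - v]| <= _)%N; last first.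
  by rewrite cards2; case: eqP.
by apply: subset_leq_card; apply/subsetP => u; rewrite !inE /= eqf_sqr.
Qed.

(** Pigeonhole: the values of u ^ 2 and of n - c w ^ 2 each fill at least half
    of a set of odd size, so they meet. *)
Lemma finField_conic (F : finFieldType) (c n : F) : odd #|F| -> c != 0 ->
  exists u w, u ^+ 2 + c * w ^+ 2 = n.
Proof.
move=> oddF c0; set A := [set u ^+ 2 | u : F]; set B := [set n - c * a | a in A].
have cB : #|B| = #|A|.
  by rewrite card_imset // => x y /addrI/oppr_inj/(mulfI c0).
have : (0 < #|A :&: B|)%N.
  rewrite -(ltn_add2l #|A :|: B|) addn0 cardsUI cB addnn -mul2n.
  apply: leq_ltn_trans (max_card _) _;
    rewrite ltn_neqAle card_squares_ge_half andbT.
  by apply: contraTneq oddF => ->; rewrite oddM.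
case/card_gt0P => x /setIP[/imsetP[u _ ->] /imsetP[a /imsetP[w _ ->] e]].
by exists u, w; rewrite e subrK.
Qed.

Lemma Fp_int_eq0 (p : nat) (k : int) : prime p -> k%:~R = 0 :> 'F_p -> (p %| k)%Z.
Proof.
move=> pp; rewrite dvdzE (dvdn_pcharf (pchar_Fp pp)).
case: k => m h /=; first by rewrite -[m%:R]/(m%:Z%:~R) h.
by rewrite -oppr_eq0 -[- _]/((Negz m)%:~R) h.
Qed.

(** For odd [p], completing the square turns the norm form into u ^ 2 + 3/4 w ^
    2, so the conic lemma applies when 3 is invertible. *)
Lemma norm_surj_mod (p : nat) (n : int) : prime p -> p != 3%N ->
  exists2 y, y \in OE & (p %| normZ y - n)%Z.
Proof.
move=> pp p3.
have [->|p2] := eqVneq p 2.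
  exists n%:~R; [exact: rpred_int | rewrite normZ_int].
  have -> : n ^+ 2 - n = n * (n - 1) by ring.
  have [h|h] : (2 %| n)%Z \/ (2 %| n - 1)%Z by lia.
    by rewrite dvdz_mulr.
  by rewrite dvdz_mull.
have podd : odd p by case: (even_prime pp) p2 => // ->.
have n0 (q : nat) : prime q -> p != q -> q%:R != 0 :> 'F_p.
  by move=> qp pq; rewrite -(dvdn_pcharf (pchar_Fp pp)) dvdn_prime2.
have c0 : 3 / 4 != 0 :> 'F_p.
  have -> : 3 / 4 = 3%:R / (2%:R * 2%:R) :> 'F_p by congr (_ / _); ring.
  by rewrite mulf_neq0 ?invr_eq0 ?mulf_neq0 ?n0.
have [|u [w e]] := @finField_conic 'F_p (3 / 4) n%:~R _ c0.
  by rewrite card_Fp.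
pose lift (x : 'F_p) : int := Posz x.
have liftK x : (lift x)%:~R = x by exact: natr_Zp.
exists ((lift (u - w / 2))%:~R + (lift w)%:~R * omega).
  by apply/OEP; exists (lift (u - w / 2)), (lift w).
apply: Fp_int_eq0 => //; rewrite normZ_coord.
rewrite !(rmorphB, rmorphD, rmorphXn, rmorphM) /= !liftK -e.
have four : 4 = 2%:R * 2%:R :> 'F_p by ring.
by field; rewrite four ?mulf_neq0 ?n0.
Qed.

(** * Representation of Hermitian matrices *)

Definition mx_represented m n (M : 'M[E]_m) (M' : 'M[E]_n) :=
  exists2 X : 'M[E]_(m, n), X \is a mxOver OE & M = X *m M' *m X ^t conjE.

Lemma mx_represented_trans m n k (M : 'M[E]_m) (M' : 'M[E]_n) (M'' : 'M[E]_k) :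
  mx_represented M M' -> mx_represented M' M'' -> mx_represented M M''.
Proof.
case=> X XO -> [Y YO ->]; exists (X *m Y); first exact: mxOverM.
by rewrite trmx_mul map_mxM !mulmxA.
Qed.

Lemma mx_represented_refl m (M : 'M[E]_m) : mx_represented M M.
Proof.
exists 1%:M; last by rewrite trmx1 map_mx1 mulmx1 mul1mx.
by apply/mxOverP => i j; rewrite mxE rpred_nat.
Qed.

Definition mx_rows m n (s : seq (seq E)) : 'M[E]_(m, n) :=
  \matrix_(i < m, j < n) nth 0 (nth [::] s i) j.

Definition herm2 (a b : int) (x : E) : 'M[E]_2 :=
  mx_rows 2 2 [:: [:: a%:~R; x]; [:: conjE x; b%:~R]].

Definition herm3 (a b c : int) (x y z : E) : 'M[E]_3 :=
  mx_rows 3 3 [:: [:: a%:~R; x; y]; [:: conjE x; b%:~R; z];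
                  [:: conjE y; conjE z; c%:~R]].

Lemma mx_rowsO m n s : all (all [in OE]) s -> mx_rows m n s \is a mxOver OE.
Proof.
move=> /allP sO; apply/mxOverP => i j; rewrite mxE.
have [hi|hi] := ltnP i (size s); last by rewrite (nth_default _ hi) nth_nil rpred0.
have /allP rO := sO _ (mem_nth [::] hi).
have [hj|hj] := ltnP j (size (nth [::] s i)); last by rewrite nth_default // rpred0.
exact: rO (mem_nth 0 hj).
Qed.

(** The first lattice is spanned by the integral combinations [s, t] and [u, v]
    of the basis of the second one; the hypotheses compute its Gram matrix. *)
Lemma herm2_change (a b a' b' : int) (x x' s t u v : E) :
  s \in OE -> t \in OE -> u \in OE -> v \in OE ->
  a%:~R = s * conjE s * a'%:~R + s * conjE t * x' + t * conjE s * conjE x'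
    + t * conjE t * b'%:~R ->
  x = s * conjE u * a'%:~R + s * conjE v * x' + t * conjE u * conjE x'
    + t * conjE v * b'%:~R ->
  b%:~R = u * conjE u * a'%:~R + u * conjE v * x' + v * conjE u * conjE x'
    + v * conjE v * b'%:~R ->
  mx_represented (herm2 a b x) (herm2 a' b' x').
Proof.
move=> sO tO uO vO ea ex eb.
exists (mx_rows 2 2 [:: [:: s; t]; [:: u; v]]);
  first by rewrite mx_rowsO //= sO tO uO vO.
apply/matrixP => i j.
rewrite mxE [RHS]mxE !big_ord_recl !big_ord0 /= !mxE !big_ord_recl !big_ord0 /= !mxE /=.
case: i => [[|[|i]] hi] //; case: j => [[|[|j]] hj] //=;
  rewrite ?ea ?eb ?ex ?(rmorphD, rmorphM) /= ?rmorph_int ?conjEK; ring.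
Qed.

(** * Maximal binary lattices *)

(** An integral overlattice whose index ideal has norm [q], hence whose
    discriminant is [q] times smaller. *)
Definition enlarges (a b : int) (x : E) (q : int) :=
  exists a' b' x', [/\ x' \in OE, 0 < a', a * b - normZ x =
    q * (a' * b' - normZ x') &
    mx_represented (herm2 a b x) (herm2 a' b' x')].

Lemma herm2_swap (a b : int) x : x \in OE ->
  mx_represented (herm2 a b x) (herm2 b a (conjE x)).
Proof.
move=> xO; apply: (@herm2_change _ _ _ _ _ _ 0 1 1 0); rewrite ?rpred0 ?rpred1 //;
  by rewrite rmorph0 rmorph1 ?conjEK; ring.
Qed.

Lemma enlarge_swap (a b : int) x q : x \in OE -> enlarges b a (conjE x) q ->
  enlarges a b x q.
Proof.
move=> xO [a' [b' [x' [x'O a'0 e h]]]]; exists a', b', x'; split=> //.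
  by rewrite -e normZ_conj mulrC.
exact: mx_represented_trans (herm2_swap a b xO) h.
Qed.

(** For t an inverse of a modulo N(z), the vector v = e2 - t (conj x) e1 pairs
    with the whole lattice, and with itself, into multiples of N(z): in other
    words e1 splits off modulo N(z) and the discriminant lives on the
    complement. So v / z can be adjoined. *)
Lemma enlarge_coprime (a b : int) x z : x \in OE -> 0 < a -> z \in OE ->
  (normZ z %| a * b - normZ x)%Z -> coprimez a (normZ z) ->
    enlarges a b x (normZ z).
Proof.
move=> xO a0 zO /dvdzP[l el] /coprimezP[[t k] /= tk].
have zz := normZE zO; have xx := normZE xO.
have tkE : t%:~R * a%:~R + k%:~R * (z * conjE z) = 1 :> E.
  by rewrite -zz; transitivity ((t * a + k * normZ z)%:~R : E); [ring | rewrite tk].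
have ebE : b%:~R = t%:~R * (x * conjE x + l%:~R * (z * conjE z))
     + k%:~R * (z * conjE z) * b%:~R :> E.
  rewrite -zz -xx -{1}[b]mulr1 -{1}tk mulrDr mulrCA [b * a]mulrC.
  by rewrite (_ : a * b = normZ x + l * normZ z); [ring | rewrite -el; ring].
(* The Gram matrix on the basis e1, v / z, where l is the new discriminant. *)
exists a, (t * l + k * b - k * t * normZ x), (x * k%:~R * z); split=> //.
- by rewrite !rpredM ?rpred_int.
- rewrite !normZM ?rpredM ?rpred_int // normZ_int el mulrC; congr (_ * _).
  transitivity (l * (t * a + k * normZ z) + k * (a * b - normZ x - l * normZ z)
    + k * normZ x * (1 - (t * a + k * normZ z))); last by ring.
  by rewrite tk el; ring.
apply: (@herm2_change _ _ _ _ _ _ 1 0 (t%:~R * conjE x) z);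
  rewrite ?rpred0 ?rpred1 ?rpredM ?OE_conj ?rpred_int //.
- by rewrite rmorph0 rmorph1; ring.
- transitivity (x * (t%:~R * a%:~R + k%:~R * (z * conjE z))).
    by rewrite tkE mulr1.
  by rewrite rmorphM /= rmorph_int conjEK; ring.
rewrite !rmorphM /= !rmorph_int conjEK.
set X := conjE x; set Z := conjE z.
transitivity (b%:~R + t%:~R * x * X * (t%:~R * a%:~R + k%:~R * (z * Z) - 1)).
  by rewrite tkE; ring.
by rewrite {1}ebE -/Z -/X !(rmorphB, rmorphD, rmorphM) /= xx -/X; ring.
Qed.

(** Here e1 / z can be adjoined. *)
Lemma enlarge_dvd_corner (a b : int) y z : z \in OE -> y \in OE -> 0 < a ->
  0 < normZ z ->
  enlarges (normZ z * a) b (z * y) (normZ z).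
Proof.
move=> zO yO a0 z0; exists a, b, y; split=> //.
  by rewrite normZM //; ring.
apply: (@herm2_change _ _ _ _ _ _ z 0 0 1); rewrite ?rpred0 ?rpred1 //;
  rewrite ?rmorph0 ?rmorph1 ?rmorphM /= ?normZE //; ring.
Qed.

(** A lattice scaled by [p] contains a primitive vector whose norm is divisible
    by p ^ 2, because a binary Hermitian form over the residue field of [p] is
    isotropic: after completing the square this asks for y with N(y) congruent
    to minus the discriminant. That vector divided by [p] can be adjoined. *)
Lemma enlarge_isotropic (p : nat) (a b : int) x : prime p -> p != 3%N -> x \in OE ->
  0 < a -> enlarges (p%:Z * a) (p%:Z * b) (p%:~R * x) (p%:Z ^+ 2).
Proof.
move=> pp p3 xO a0; have p0 := prime_gt0 pp.
have [/dvdzP[a1 ea]|pa] := boolP (p %| a)%Z.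
  have -> : p%:Z * a = normZ (p%:Z%:~R) * a1 by rewrite normZ_int ea; ring.
  rewrite -normZ_int; apply: enlarge_dvd_corner => //;
    rewrite ?rpred_int // ?normZ_int; nia.
have pcop : coprimez p a by rewrite coprimezE prime_coprime.
have [[k t] /= tk] := coprimezP _ _ pcop.
have [y yO /dvdzP[l el]] := norm_surj_mod (- (a * b - normZ x)) pp p3.
(* The isotropic vector is s e1 + e2, of norm h for the form divided by p; up to
   a multiple of p, a s + conj x is y. *)
set s := t%:~R * (y - conjE x).
have sO : s \in OE by rewrite rpredM ?rpred_int ?rpredB ?OE_conj.
set h : int := normZ s * a + traceZ (s * x) + b.
have ah : a * h = normZ (s * a%:~R + conjE x) + a * b - normZ x.
  apply: intE_inj.
  transitivity (a%:~R * ((normZ s)%:~R * a%:~R + (traceZ (s * x))%:~R + b%:~R) : E).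
    by rewrite /h; ring.
  transitivity ((normZ (s * a%:~R + conjE x))%:~R + a%:~R * b%:~R - (normZ x)%:~R : E); last by ring.
  rewrite !normZE ?traceZE ?rpredD ?rpredM ?rpredB ?rpred_int ?OE_conj //.
  by rewrite !(rmorphD, rmorphM) /= rmorph_int conjEK; ring.
have ph : (p %| h)%Z.
  rewrite -(Gauss_dvdzr h pcop) ah.
  have -> : s * a%:~R + conjE x = y + (- p%:Z)%:~R * (k%:~R * (y - conjE x)).
    have -> : s * a%:~R = (t * a)%:~R * (y - conjE x) by rewrite /s; ring.
    by rewrite (_ : t * a = 1 - k * p); [ring | rewrite -tk; ring].
  have wO : k%:~R * (y - conjE x) \in OE by rewrite rpredM ?rpred_int ?rpredB ?OE_conj.
  rewrite normZD //; set w := traceZ _; set n' := normZ (_ * _).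
  apply/dvdzP; exists (l - w + p%:Z * n').
  have -> : normZ y = l * p%:Z - (a * b - normZ x) by rewrite -el; ring.
  by ring.
have [h' eh] := dvdzP ph.
clearbody s.
exists (p%:Z * a), h', (conjE s * a%:~R + x); split=> //.
- by rewrite rpredD // rpredM ?rpred_int ?OE_conj.
- by nia.
- have -> : normZ (conjE s * a%:~R + x) = normZ (s * a%:~R + conjE x).
    by rewrite -normZ_conj rmorphD rmorphM /= conjEK rmorph_int.
  have -> : normZ (s * a%:~R + conjE x) =
    a * h - (a * b - normZ x) by rewrite ah; ring.
  by rewrite normZM ?rpred_int // normZ_int eh; ring.
apply: (@herm2_change _ _ _ _ _ _ 1 0 (- s) p%:~R);
  rewrite ?rpred0 ?rpred1 ?rpredN ?rpred_int //.
- by rewrite rmorph0 rmorph1; ring.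
- by rewrite !rmorphN /= rmorph_int; ring.
rewrite !(rmorphN, rmorphD, rmorphM) /= !rmorph_int conjEK.
have hE : p%:Z%:~R * h'%:~R = s * conjE s * a%:~R + s * x + conjE (s * x) + b%:~R :> E.
  transitivity ((normZ s)%:~R * a%:~R + (traceZ (s * x))%:~R + b%:~R : E).
    by transitivity (h%:~R : E); [rewrite eh; ring | rewrite /h; ring].
  have sxO : s * x \in OE by exact: rpredM.
  by rewrite normZE // traceZE // addrA.
rewrite [conjE (s * x)]rmorphM /= in hE.
transitivity (p%:~R * (p%:~R * h'%:~R - s * conjE s * a%:~R - s * x - conjE s * conjE x) : E).
  by rewrite hE; ring.
ring.
Qed.

(** Stated through norms; for a prime [p] this is equivalent to [p] remaining
    prime in the Eisenstein integers. *)
Definition inert (p : nat) := forall x, x \in OE -> (p %| normZ x)%Z -> dvdO p x.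

(** The ramified prime is excluded by 1 + omega, of norm 3. *)
Lemma inert_prime_neq3 p : inert p -> p != 3%N.
Proof.
move=> hp; apply/eqP => p3.
have xO : 1%:~R + 1%:~R * omega \in OE by apply/OEP; exists 1, 1.
have := hp _ xO; rewrite p3 normZ_coord => /(_ isT) /dvdO_coord[].
by [].
Qed.

Lemma herm2_corner_gt0 (a b : int) x : x \in OE -> 0 < a ->
  0 < a * b - normZ x -> 0 < b.
Proof. by move=> /normZ_ge0; nia. Qed.

(** If a diagonal entry is prime to [p], it splits off. If both are divisible by
    [p], then so is N(x), hence [x] is divisible by one of the two primes above
    [p], and a basis vector can be divided by that prime. *)
Lemma enlarge_split (p : nat) (a b : int) x z : prime p -> z \in OE ->
  normZ z = p ->
  x \in OE -> 0 < a -> 0 < a * b - normZ x -> (p %| a * b - normZ x)%Z ->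
  enlarges a b x p.
Proof.
move=> pp zO nz xO a0 d0 pd; have p0 := prime_gt0 pp.
have cop c : ~ (p %| c)%Z -> coprimez c (normZ z).
  by move=> /negP pc; rewrite nz coprimez_sym coprimezE prime_coprime.
have [pa|pa] := pselect (p %| a)%Z; last first.
  by rewrite -nz; apply: enlarge_coprime => //; [rewrite nz | exact: cop].
have : (p %| normZ x)%Z.
  have -> : normZ x = a * b - (a * b - normZ x) by ring.
  by rewrite rpredB // dvdz_mulr.
have [a1 ea] := dvdzP pa.
case/(split_prime pp zO nz xO) => y yO ex.
rewrite ea mulrC -nz; case: ex => ->; last rewrite -(normZ_conj z);
  by apply: enlarge_dvd_corner; rewrite ?OE_conj ?normZ_conj ?nz //; nia.
Qed.

(** If no diagonal entry is prime to [p], then p divides N(x), hence x, as [p]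
    is inert; so the whole form is divisible by [p]. *)
Lemma enlarge_inert (p : nat) (a b : int) x : prime p -> inert p ->
  x \in OE -> 0 < a -> 0 < a * b - normZ x -> (p%:Z ^+ 2 %| a * b - normZ x)%Z ->
  enlarges a b x (p%:Z ^+ 2).
Proof.
move=> pp ip xO a0 d0 pd; have p0 := prime_gt0 pp.
have [z zO nz] : exists2 z, z \in OE & normZ z = p%:Z ^+ 2.
  by exists p%:~R; [exact: rpred_int | exact: normZ_int].
have cop c : ~ (p %| c)%Z -> coprimez c (normZ z).
  move=> /negP pc; rewrite nz coprimez_sym coprimezXl //.
  by rewrite coprimezE prime_coprime.
have b0 := herm2_corner_gt0 xO a0 d0.
have [pa|pa] := pselect (p %| a)%Z; last first.
  by rewrite -nz; apply: enlarge_coprime => //; [rewrite nz | exact: cop].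
have [pb|pb] := pselect (p %| b)%Z; last first.
  apply: enlarge_swap => //; rewrite -nz; apply: enlarge_coprime;
    rewrite ?OE_conj //.
    by rewrite normZ_conj nz mulrC.
  exact: cop.
have : (p %| normZ x)%Z.
  have -> : normZ x = a * b - (a * b - normZ x) by ring.
  by rewrite rpredB ?dvdz_mulr //; apply: dvdz_trans pd; rewrite expr2 dvdz_mulr.
case/(ip _ xO) => y yO ->.
have [a1 ea] := dvdzP pa; have [b1 eb] := dvdzP pb.
rewrite ea eb ![_ * p%:Z]mulrC; apply: enlarge_isotropic => //;
  first exact: inert_prime_neq3.
nia.
Qed.

Definition inert_squarefree (d : int) := forall p : nat, prime p -> (p %| d)%Z ->
  inert p /\ ~ (p%:Z ^+ 2 %| d)%Z.

(** Enlarging lowers the positive integer a b - N(x), so the process stops, and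
    it can only stop at a product of distinct inert primes. *)
Lemma binary_maximal (a b : int) x : x \in OE -> 0 < a -> 0 < a * b - normZ x ->
  exists a' b' x', [/\ x' \in OE, 0 < a', 0 < a' * b' - normZ x',
    inert_squarefree (a' * b' - normZ x') &
    mx_represented (herm2 a b x) (herm2 a' b' x')].
Proof.
have [n] := ubnP (absz (a * b - normZ x)%R).
elim: n a b x => // n IH a b x dn xO a0 d0.
have step q : 1 < q -> enlarges a b x q ->
    exists a' b' x', [/\ x' \in OE, 0 < a', 0 < a' * b' - normZ x',
      inert_squarefree (a' * b' - normZ x') &
    mx_represented (herm2 a b x) (herm2 a' b' x')].
  move=> q1 [a' [b' [x' [x'O a'0 ed h]]]].
  have d'0 : 0 < a' * b' - normZ x' by nia.
  have dd : a' * b' - normZ x' < a * b - normZ x by nia.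
  have [||||a2 [b2 [x2 [h1 h2 h3 h4 h5]]]] := IH a' b' x'; rewrite //; first by lia.
  by exists a2, b2, x2; split=> //; apply: mx_represented_trans h h5.
have [red|nred] := pselect (inert_squarefree (a * b - normZ x)).
  exists a, b, x; split=> //; exact: mx_represented_refl.
move/existsNP: nred => [p /not_implyP[pp /not_implyP[pd h]]].
have p1 := prime_gt1 pp.
case: (norm_or_inert pp) => [[z zO nz]|ip].
  by apply: (step p); [lia | exact: enlarge_split nz _ _ _ _].
apply: (step (p%:Z ^+ 2)); first by nia.
by apply: enlarge_inert => //; apply: contrapT => h2; apply: h.
Qed.

(** * Bordering a binary form *)

Lemma traceZD x y (k : int) : x \in OE -> y \in OE ->
  traceZ (x + k%:~R * y) = traceZ x + k * traceZ y.
Proof.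
move=> xO yO; apply: intE_inj; rewrite traceZE ?rpredD ?rpredM ?rpred_int //.
transitivity ((traceZ x)%:~R + k%:~R * (traceZ y)%:~R : E); last by ring.
by rewrite !traceZE // rmorphD rmorphM /= rmorph_int; ring.
Qed.

(** The Hermitian form of the adjugate of [herm2 a b x] at the column (y, z), so
    that bordering [herm2 a b x] by this column and the corner [c] yields the
    determinant c (a b - N(x)) - adj_form. *)
Definition adj_form (a b : int) (x y z : E) : int :=
  b * normZ y + a * normZ z - traceZ (x * z * conjE y).

Lemma adj_form_mod a b x y z y' z' (k : int) : x \in OE -> y \in OE -> z \in OE ->
  y' \in OE -> z' \in OE ->
  exists l, adj_form a b x (y + k%:~R * y') (z + k%:~R * z') =
    adj_form a b x y z + k * l.
Proof.
move=> xO yO zO y'O z'O; rewrite /adj_form !normZD //.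
have -> : x * (z + k%:~R * z') * conjE (y + k%:~R * y') = x * z * conjE y + k%:~R *
    (x * (z * conjE y' + z' * conjE y + k%:~R * (z' * conjE y'))).
  by rewrite rmorphD rmorphM /= rmorph_int; ring.
rewrite traceZD; first last.
- by rewrite !(rpredM, rpredD) ?OE_conj ?rpred_int.
- by rewrite !rpredM ?OE_conj.
set t := traceZ (x * (_ + _)); set u := traceZ (y * _); set v := traceZ (z * _).
exists (b * (u + k * normZ y') + a * (v + k * normZ z') - t); ring.
Qed.

(** As [p ^ 2] does not divide the discriminant, some diagonal entry is prime to
    [p]; on that axis the form is a unit times the norm, which is onto modulo
    [p]. *)
Lemma adj_form_local (p : nat) a b x (n : int) : prime p -> x \in OE ->
  inert p -> ~ (p%:Z ^+ 2 %| a * b - normZ x)%Z -> (p %| a * b - normZ x)%Z ->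
  exists y z, [/\ y \in OE, z \in OE & (p %| adj_form a b x y z + n)%Z].
Proof.
move=> pp xO ip p2d pd; have p3 := inert_prime_neq3 ip.
have tr0 : traceZ 0 = 0 by rewrite /traceZ rmorph0 addr0 (toZK 0).
have nm0 : normZ 0 = 0 by rewrite (normZ_int 0).
have main c : ~ (p %| c)%Z -> exists2 y, y \in OE & (p %| c * normZ y + n)%Z.
  move=> /negP pc; have pcop : coprimez p c by rewrite coprimezE prime_coprime.
  have [[k t] /= tk] := coprimezP _ _ pcop.
  have [y yO /dvdzP[l el]] := norm_surj_mod (- (t * n)) pp p3.
  exists y => //; apply/dvdzP; exists (c * l + n * k).
  rewrite (_ : normZ y = l * p - t * n); last by rewrite -el; ring.
  transitivity (c * l * p + n * (k * p + t * c) - c * t * n);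
    first by rewrite tk; ring.
  ring.
have [pa|pa] := pselect (p %| a)%Z; last first.
  have [z zO hz] := main _ pa; exists 0, z; split; rewrite ?rpred0 //.
  by rewrite /adj_form rmorph0 mulr0 tr0 nm0 mulr0 add0r subr0.
have [pb|pb] := pselect (p %| b)%Z; last first.
  have [y yO hy] := main _ pb; exists y, 0; split; rewrite ?rpred0 //.
  by rewrite /adj_form mulr0 mul0r tr0 nm0 mulr0 addr0 subr0.
case: p2d; have [a1 ->] := dvdzP pa; have [b1 ->] := dvdzP pb.
have [] := ip x xO.
  have -> : normZ x = a * b - (a * b - normZ x) by ring.
  by rewrite rpredB // dvdz_mulr.
move=> q qO ->; rewrite normZM ?rpred_int // normZ_int.
by apply/dvdzP; exists (a1 * b1 - normZ q); ring.
Qed.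

(** The corner [c] exists as soon as adj_form is congruent to - n modulo the
    discriminant. The solutions modulo each prime divisor are glued by the
    Chinese remainder theorem, the divisors being pairwise coprime. *)
Lemma ternary_completion a b x (n : int) : x \in OE -> 0 < a * b - normZ x ->
  inert_squarefree (a * b - normZ x) ->
  exists y z c, [/\ y \in OE, z \in OE &
    c * (a * b - normZ x) - adj_form a b x y z = n].
Proof.
move=> xO d0 red; set d := a * b - normZ x.
suff main (e : nat) : (0 < e)%N -> (e %| d)%Z ->
    exists y z, [/\ y \in OE, z \in OE & (e %| adj_form a b x y z + n)%Z].
  have [||y [z [yO zO /dvdzP[c ec]]]] := main (absz d); try (rewrite /d; lia).
    by rewrite abszE gtr0_norm.
  exists y, z, c; split=> //; rewrite -/d; move: ec;
    rewrite abszE gtr0_norm // => <-; ring.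
elim/ltn_ind: e => e IH e0 ed.
have [e1|e1] := leqP e 1.
  exists 0, 0; split; rewrite ?rpred0 //.
  by rewrite (_ : e = 1%N) ?dvd1z //; lia.
have pp := pdiv_prime e1; set p := pdiv e in pp.
have [e' ee] : exists e', e = (e' * p)%N by apply/dvdnP; exact: pdiv_dvd.
have p1 := prime_gt1 pp.
have pd : (p %| d)%Z by apply: dvdz_trans ed; rewrite ee PoszM dvdz_mull.
have e'd : (e' %| d)%Z by apply: dvdz_trans ed; rewrite ee PoszM dvdz_mulr.
have [ip p2d] := red p pp pd.
have cop : coprimez p e'.
  rewrite coprimezE prime_coprime //; apply/negP => /dvdnP[k /= ek]; apply: p2d.
  by apply: dvdz_trans ed; rewrite ee ek !PoszM expr2 -mulrA dvdz_mull.
have [[u v] /= uv] := coprimezP _ _ cop.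
have uvE : u%:~R * p%:~R + v%:~R * e'%:~R = 1 :> E.
  by transitivity ((u * p + v * e')%:~R : E); [ring | rewrite uv].
have e'0 : (0 < e')%N by case: (e') ee e0 => // ->.
have e'e : (e' < e)%N by rewrite ee ltn_Pmulr.
have [y' [z' [y'O z'O h']]] := IH e' e'e e'0 e'd.
have [y [z [yO zO h]]] := adj_form_local n pp xO ip p2d pd.
exists (y + p%:~R * (u%:~R * (y' - y))), (z + p%:~R * (u%:~R * (z' - z))).
(* By the Bezout relation u p + v e' = 1 the chosen point is (y, z) modulo p and
   (y', z') modulo e'. *)
have glue (w w' : E) : w + p%:~R * (u%:~R * (w' - w)) =
  w' + e'%:~R * (v%:~R * (w - w')).
  transitivity (w' + (w - w') * (u%:~R * p%:~R + v%:~R * e'%:~R) +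
     (w' - w) * (u%:~R * p%:~R)); last by ring.
  by rewrite uvE; ring.
split; try by rewrite ?rpredD ?rpredM ?rpredB ?rpred_int.
rewrite ee mulnC PoszM Gauss_dvdz //.
apply/andP; split.
  have [||||| l ->] := @adj_form_mod a b x y z (u%:~R * (y' - y)) (u%:~R * (z' - z)) p;
    rewrite ?rpredM ?rpredB ?rpred_int //.
  by rewrite addrAC rpredD // dvdz_mulr.
rewrite !glue.
have [||||| l ->] := @adj_form_mod a b x y' z' (v%:~R * (y - y')) (v%:~R * (z - z')) e';
    rewrite ?rpredM ?rpredB ?rpred_int //.
by rewrite addrAC rpredD // dvdz_mulr.
Qed.

(** * Elementary moves on ternary forms *)

Definition tern_form (a b c : int) (x y z : E) (u v : E * E * E) : E :=
  let: (u1, u2, u3) := u in let: (v1, v2, v3) := v in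
  u1 * (conjE v1 * a%:~R + conjE v2 * x + conjE v3 * y) +
  u2 * (conjE v1 * conjE x + conjE v2 * b%:~R + conjE v3 * z) +
  u3 * (conjE v1 * conjE y + conjE v2 * conjE z + conjE v3 * c%:~R).

Lemma tern_formC a b c x y z u v :
  tern_form a b c x y z v u = conjE (tern_form a b c x y z u v).
Proof.
case: u v => [[u1 u2] u3] [[v1 v2] v3] /=.
by rewrite !(rmorphD, rmorphM) /= ?conjEK !rmorph_int; ring.
Qed.


Definition triO (u : E * E * E) := [&& u.1.1 \in OE, u.1.2 \in OE & u.2 \in OE].

Definition tri_rows m (s : seq (E * E * E)) : 'M[E]_(m, 3) :=
  mx_rows m 3 [seq [:: u.1.1; u.1.2; u.2] | u <- s].

Lemma tri_rowsO m s : all triO s -> tri_rows m s \is a mxOver OE.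
Proof.
move=> sO; apply: mx_rowsO; rewrite all_map;
  apply: sub_all sO => u /and3P[h1 h2 h3] /=.
by rewrite h1 h2 h3.
Qed.

Lemma tri_rows_gram m s a b c x y z (i j : 'I_m) : size s = m ->
  (tri_rows m s *m herm3 a b c x y z *m (tri_rows m s) ^t conjE) i j =
  tern_form a b c x y z (nth (0, 0, 0) s i) (nth (0, 0, 0) s j).
Proof.
move=> sm.
have hi : (i < size s)%N by rewrite sm.
have hj : (j < size s)%N by rewrite sm.
rewrite mxE !big_ord_recl !big_ord0 /= !mxE !big_ord_recl !big_ord0 /= !mxE /=.
rewrite !(nth_map (0, 0, 0)) //=.
by case: (nth _ s i) (nth _ s j) => [[u1 u2] u3] [[v1 v2] v3] /=; ring.
Qed.

Lemma tri_rows_represented m (M : 'M[E]_m) s a b c x y z : size s = m ->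
  all triO s ->
  (forall i j : 'I_m, M i j = tern_form a b c x y z (nth (0, 0, 0) s i) (nth (0,
    0, 0) s j)) ->
  mx_represented M (herm3 a b c x y z).
Proof.
move=> sm sO h; exists (tri_rows m s); first exact: tri_rowsO.
by apply/matrixP => i j; rewrite tri_rows_gram // h.
Qed.

Lemma herm3_change (a b c a' b' c' : int) x y z x' y' z' u v w
    (f := tern_form a' b' c' x' y' z') :
  triO u -> triO v -> triO w ->
  [/\ a%:~R = f u u, b%:~R = f v v & c%:~R = f w w] ->
  [/\ x = f u v, y = f u w & z = f v w] ->
  mx_represented (herm3 a b c x y z) (herm3 a' b' c' x' y' z').
Proof.
move=> uO vO wO [ea eb ec] [ex ey ez].
apply: (@tri_rows_represented _ _ [:: u; v; w]) => //=; first by rewrite uO vO wO.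
move=> [[|[|[|i]]] hi] [[|[|[|j]]] hj] //; rewrite mxE /= -/f //;
  by rewrite /f tern_formC -/f -?ex -?ey -?ez.
Qed.

Lemma herm2_in_herm3 (a b c : int) x y z : mx_represented (herm2 a b x) (herm3 a b c x y z).
Proof.
apply: (@tri_rows_represented _ _ [:: (1, 0, 0); (0, 1, 0)]); rewrite //=.
  by rewrite /triO /= rpred0 rpred1.
move=> [[|[|i]] hi] [[|[|j]] hj] //; rewrite mxE /= !rmorph0 !rmorph1; ring.
Qed.

Definition tern_det (a b c : int) (x y z : E) : E :=
  a%:~R * b%:~R * c%:~R + x * z * conjE y + conjE (x * z) * y - a%:~R * (z * conjE z)
  - b%:~R * (y * conjE y) - c%:~R * (x * conjE x).

(** A positive ternary form of determinant [D]: for [D > 0] the leading minors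
    [a], [a b - N(x)] and [D] are positive. *)
Record tern (D a b c : int) (x y z : E) := Tern {
  tern_x : x \in OE; tern_y : y \in OE; tern_z : z \in OE;
  tern_a0 : 0 < a; tern_k0 : 0 < a * b - normZ x;
  tern_detE : tern_det a b c x y z = D%:~R }.

Lemma tern_swap12 D a b c x y z : tern D a b c x y z ->
  tern D b a c (conjE x) z y /\ mx_represented (herm3 a b c x y z) (herm3 b a c (conjE x) z y).
Proof.
case=> xO yO zO a0 k0 dE; split.
  split=> //; rewrite ?OE_conj //.
  - exact: herm2_corner_gt0 xO a0 k0.
  - by rewrite normZ_conj mulrC.
  by rewrite -dE /tern_det !(rmorphD, rmorphM) /= conjEK; ring.
apply: (@herm3_change _ _ _ _ _ _ _ _ _ _ _ _ (0, 1, 0) (1, 0, 0) (0, 0, 1));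
  rewrite ?/triO /= ?rpred0 ?rpred1 //; split; rewrite !rmorph0 !rmorph1 ?conjEK;
    ring.
Qed.

(** The Schur complement of the corner [a], scaled by [a], is the binary form
    with entries a b - N(x), a z - conj x y and a c - N(y); this is Sylvester's
    identity for its determinant. *)
Lemma tern_schur_complement D a b c x y z : tern D a b c x y z ->
  (a * b - normZ x) * (a * c - normZ y) - normZ (a%:~R * z - conjE x * y) = a * D.
Proof.
case=> xO yO zO a0 k0 dE; apply: intE_inj.
rewrite !(rmorphB, rmorphM) /= !normZE //;
  last by rewrite rpredB ?rpredM ?OE_conj ?rpred_int.
rewrite -dE /tern_det !(rmorphB, rmorphM) /= conjEK !rmorph_int; ring.
Qed.

(** The new second minor a c - N(y) is positive since the Schur complement is
    positive definite. *)
Lemma tern_swap23 D a b c x y z : 0 < D -> tern D a b c x y z ->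
  tern D a c b y x (conjE z) /\ mx_represented (herm3 a b c x y z) (herm3 a c b y x (conjE z)).
Proof.
move=> D0 t; have := tern_schur_complement t; case: t => xO yO zO a0 k0 dE schur;
  split.
  split=> //; rewrite ?OE_conj //.
    have : 0 < (a * b - normZ x) * (a * c - normZ y).
      have : 0 <= normZ (a%:~R * z - conjE x * y).
        by rewrite normZ_ge0 // rpredB ?rpredM ?OE_conj ?rpred_int.
      have : 0 < a * D by rewrite mulr_gt0.
      by move: schur; lia.
    by rewrite pmulr_rgt0.
  by rewrite -dE /tern_det !(rmorphD, rmorphM) /= conjEK; ring.
apply: (@herm3_change _ _ _ _ _ _ _ _ _ _ _ _ (1, 0, 0) (0, 0, 1) (0, 1, 0));
  rewrite ?/triO /= ?rpred0 ?rpred1 //; split; rewrite !rmorph0 !rmorph1 ?conjEK;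
    ring.
Qed.

(** Subtracting a multiple of e2 from e3 reduces the off-diagonal entry of the
    Schur complement. *)
Lemma tern_shear3 D a b c x y z : tern D a b c x y z -> exists c' y' z',
  [/\ tern D a b c' x y' z', mx_represented (herm3 a b c x y z) (herm3 a b c' x y' z') &
      3 * normZ (a%:~R * z' - conjE x * y') <= (a * b - normZ x) ^+ 2].
Proof.
case=> xO yO zO a0 k0 dE.
have [|r rO hr] := @OE_div_int (a%:~R * z - conjE x * y) _ k0.
  by rewrite rpredB ?rpredM ?OE_conj ?rpred_int.
pose c' := c - traceZ (conjE r * z) + normZ r * b.
have cE : c'%:~R = c%:~R - conjE r * z - r * conjE z + r * conjE r * b%:~R :> E.
  transitivity (c%:~R - (traceZ (conjE r * z))%:~R + (normZ r)%:~R * b%:~R : E).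
    by rewrite /c'; ring.
  by rewrite normZE // traceZE ?rpredM ?OE_conj // rmorphM /= conjEK; ring.
exists c', (y - r * x), (z - r * b%:~R); split.
- split=> //; try by rewrite rpredB ?rpredM ?rpred_int.
  rewrite -dE /tern_det cE !(rmorphB, rmorphM) /= !rmorph_int; ring.
- apply: (@herm3_change _ _ _ _ _ _ _ _ _ _ _ _ (1, 0, 0) (0, 1, 0) (0, conjE r,
    1));
    rewrite ?/triO /= ?rpred0 ?rpred1 ?OE_conj // !rmorph0 !rmorph1 ?conjEK;
    split; rewrite ?cE ?(rmorphB, rmorphM) /= ?rmorph_int; ring.
move: hr; congr (3 * normZ _ <= _).
by rewrite rmorphB rmorphM /= normZE //; ring.
Qed.

(** Subtracting a multiple of e1 from e2 reduces [x] and does not affect the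
    Schur complement, so it can follow the previous reduction. *)
Lemma tern_shear2 D a b c x y z : tern D a b c x y z -> exists b' x' z',
  [/\ tern D a b' c x' y z', mx_represented (herm3 a b c x y z) (herm3 a b' c x' y z'),
      3 * normZ x' <= a ^+ 2, a * b' - normZ x' = a * b - normZ x &
      a%:~R * z' - conjE x' * y = a%:~R * z - conjE x * y].
Proof.
case=> xO yO zO a0 k0 dE.
have [r rO hr] := OE_div_int a0 xO.
pose b' := b - traceZ (conjE r * x) + normZ r * a.
have bE : b'%:~R = b%:~R - conjE r * x - r * conjE x + r * conjE r * a%:~R :> E.
  transitivity (b%:~R - (traceZ (conjE r * x))%:~R + (normZ r)%:~R * a%:~R : E).
    by rewrite /b'; ring.
  by rewrite normZE // traceZE ?rpredM ?OE_conj // rmorphM /= conjEK; ring.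
have x'O : x - a%:~R * r \in OE by rewrite rpredB ?rpredM ?rpred_int.
have z'O : z - conjE r * y \in OE by rewrite rpredB ?rpredM ?OE_conj.
have ek : a * b' - normZ (x - a%:~R * r) = a * b - normZ x.
  apply: intE_inj; rewrite !(rmorphB, rmorphM) /= !normZE // bE.
  by rewrite !(rmorphB, rmorphM) /= !rmorph_int; ring.
exists b', (x - a%:~R * r), (z - conjE r * y); split=> //.
- split=> //; first by rewrite ek.
  by rewrite -dE /tern_det bE !(rmorphB, rmorphM) /= !rmorph_int conjEK; ring.
- apply: (@herm3_change _ _ _ _ _ _ _ _ _ _ _ _ (1, 0, 0) (conjE r, 1, 0) (0, 0,
    1));
    rewrite ?/triO /= ?rpred0 ?rpred1 ?OE_conj // !rmorph0 !rmorph1 ?conjEK;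
    split; rewrite ?bE ?(rmorphB, rmorphM) /= ?rmorph_int; ring.
by rewrite rmorphB rmorphM /= rmorph_int; ring.
Qed.

(** * Ternary forms of determinant at most two *)

(** The reduction inequalities give 2 a ^ 2 <= 3 k and 2 k ^ 2 <= 3 a D, whence
    8 a ^ 3 <= 27 D <= 54 and a < 2; then 2 k ^ 2 <= 6 and k < 2. *)
Lemma hermite_bound (D a b k l m n : int) : D <= 2 -> 0 < a -> 0 < k ->
  a <= b -> k <= l -> 3 * m <= a ^+ 2 -> 3 * n <= k ^+ 2 ->
  k = a * b - m -> k * l - n = a * D -> a = 1 /\ k = 1.
Proof.
move=> D2 a0 k0 ab kl hm hn ek ed.
have h1 : a * a <= a * b by rewrite ler_pM2l.
have h2 : 2 * a ^+ 2 <= 3 * k by lia.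
have h3 : k * k <= k * l by rewrite ler_pM2l.
have h4 : a * D <= a * 2 by rewrite ler_pM2l.
have h5 : k ^+ 2 <= 3 * a by lia.
have h6 : (2 * a ^+ 2) ^+ 2 <= (3 * k) ^+ 2 by rewrite lerXn2r // nnegrE; lia.
have h7 : a * (4 * a ^+ 3) <= a * 27 by lia.
have h8 : 4 * a ^+ 3 <= 27 by move: h7; rewrite ler_pM2l.
have a1 : a = 1.
  have [a2|] := lerP 2 a; last by lia.
  have : 2 ^+ 3 <= a ^+ 3 by rewrite lerXn2r // nnegrE; lia.
  by lia.
split=> //; have [k2|] := lerP 2 k; last by lia.
have : 2 ^+ 2 <= k ^+ 2 by rewrite lerXn2r // nnegrE; lia.
by lia.
Qed.

(** When the first two leading minors are 1, the triangular factorization needs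
    no denominators. *)
Lemma tern_cholesky D b c x y z : tern D 1 b c x y z -> b - normZ x = 1 ->
  mx_represented (herm3 1 b c x y z) (herm3 1 1 D 0 0 0).
Proof.
move=> t k1; have := tern_schur_complement t; case: t => xO yO zO _ _ _.
rewrite (_ : 1%:~R = 1) // !mul1r k1 mul1r => sch.
have gO : z - conjE x * y \in OE by rewrite rpredB ?rpredM ?OE_conj.
have bE : b%:~R = x * conjE x + 1 :> E.
  by rewrite -normZE // (_ : b = normZ x + 1); [ring | lia].
have cE : c%:~R = y * conjE y + (z - conjE x * y) * conjE (z - conjE x * y) + D%:~R :> E.
  rewrite -!normZE // (_ : c = normZ y + normZ (z - conjE x * y) + D);
    first by ring.
  by rewrite -sch; ring.
apply: (@herm3_change _ _ _ _ _ _ _ _ _ _ _ _ (1, 0, 0) (conjE x, 1, 0)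
   (conjE y, conjE (z - conjE x * y), 1));
  rewrite ?/triO /= ?rpred0 ?rpred1 ?OE_conj // !rmorph0 !rmorph1 ?conjEK;
  split; rewrite ?bE ?cE; ring.
Qed.

(** Hermite reduction. The two shears make the off-diagonal entries small at no
    cost; a swap that improves the diagonal lowers [a], or keeps [a] and lowers
    the second minor. When no swap helps, both minors are 1 by the Hermite
    bound. *)
Lemma tern_reduce D a b c x y z : 0 < D -> D <= 2 -> tern D a b c x y z ->
  mx_represented (herm3 a b c x y z) (herm3 1 1 D 0 0 0).
Proof.
move=> D0 D2; have [n] := ubnP (absz a).
elim: n a b c x y z => // n IHa a b c x y z an.
have [m] := ubnP (absz (a * b - normZ x)%R).
elim: m b c x y z => // m IHk b c x y z km t.
have [c1 [y1 [z1 [t1 r1 h1]]]] := tern_shear3 t; apply: mx_represented_trans r1 _.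
have [b2 [x2 [z2 [t2 r2 h2 k2 B2]]]] := tern_shear2 t1;
  apply: mx_represented_trans r2 _.
rewrite -B2 -k2 in h1; rewrite -k2 in km; have a0 := tern_a0 t2.
have [b2a|ab] := ltrP b2 a.
  have [t3 r3] := tern_swap12 t2; apply: mx_represented_trans r3 _.
  by have a3 := tern_a0 t3; apply: IHa t3; lia.
have sch := tern_schur_complement t2.
have [kk|kk] := ltrP (a * c1 - normZ y1) (a * b2 - normZ x2).
  have [t3 r3] := tern_swap23 D0 t2; apply: mx_represented_trans r3 _.
  by have k3 := tern_k0 t3; apply: IHk t3; lia.
have [a1 k1] := hermite_bound D2 a0 (tern_k0 t2) ab kk h2 h1 erefl sch.
subst a; apply: tern_cholesky t2 _.
by rewrite mul1r in k1.
Qed.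

Lemma binary_represented D a b x : 0 < D -> D <= 2 -> x \in OE -> 0 < a ->
  0 < a * b - normZ x ->
  mx_represented (herm2 a b x) (herm3 1 1 D 0 0 0).
Proof.
move=> D0 D2 xO a0 d0.
have [a' [b' [x' [x'O a'0 d'0 red r]]]] := binary_maximal xO a0 d0.
have [y [z [c [yO zO ec]]]] := ternary_completion D x'O d'0 red.
apply: mx_represented_trans r _;
  apply: mx_represented_trans (herm2_in_herm3 a' b' c x' y z) _.
apply: tern_reduce => //; split=> //.
rewrite -ec /tern_det /adj_form.
transitivity (c%:~R * (a'%:~R * b'%:~R - (normZ x')%:~R) - (b'%:~R * (normZ y)%:~R +
   a'%:~R * (normZ z)%:~R - (traceZ (x' * z * conjE y))%:~R) : E); last by ring.
rewrite !normZE // traceZE ?rpredM ?OE_conj // !(rmorphM) /= conjEK; ring.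
Qed.

(** * Integral spans and Gram matrices *)

Lemma hformC (L : hermLattice) u v : hl_form L u v = conjE (hl_form L v u).
Proof. by rewrite hermC /= expr0 mul1r. Qed.

Lemma hformZl (L : hermLattice) a u v : hl_form L (a *: u) v = a * hl_form L u v.
Proof. exact: linearZl_LR. Qed.

Lemma hformZr (L : hermLattice) a u v : hl_form L u (a *: v) =
  conjE a * hl_form L u v.
Proof. exact: linearZr_LR. Qed.

Lemma hform_sumr (L : hermLattice) n u (F : 'I_n -> hl_space L) :
  hl_form L u (\sum_i F i) = \sum_i hl_form L u (F i).
Proof. exact: linear_sumr. Qed.

Lemma hform_suml (L : hermLattice) n (F : 'I_n -> hl_space L) u :
  hl_form L (\sum_i F i) u = \sum_i hl_form L (F i) u.
Proof. exact: linear_sumlz. Qed.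

Lemma Ospan_tupleP (V : vectType E) n (b : n.-tuple V) v :
  in_Ospan b v <-> exists2 c : 'I_n -> E, forall i, c i \in OE & v =
    \sum_i c i *: tnth b i.
Proof.
split=> [[c [cO ->]]|[c cO ->]].
  exists (fun i => c i) => //.
  rewrite -(big_mkord xpredT (fun i => c i *: b`_i)) size_tuple big_mkord.
  by apply: eq_bigr => i _; rewrite (tnth_nth 0).
exists (fun k => if insub k is Some i then c i else 0); split.
  by move=> k; case: insubP => [i _ _|_]; rewrite ?rpred0.
rewrite -(big_mkord xpredT (fun k => (if insub k is Some i then c i else 0) *: b`_k)).
rewrite size_tuple big_mkord; apply: eq_bigr => i _.
by rewrite valK (tnth_nth 0).
Qed.

Lemma OspanD (V : vectType E) (s : seq V) u v : in_Ospan s u -> in_Ospan s v ->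
  in_Ospan s (u + v).
Proof.
case=> c [cO ->] [d [dO ->]]; exists (fun i => c i + d i); split=> [i|].
  by rewrite rpredD.
by rewrite -big_split; apply: eq_bigr => i _; rewrite scalerDl.
Qed.

Lemma OspanZ (V : vectType E) (s : seq V) a v : a \in OE -> in_Ospan s v ->
  in_Ospan s (a *: v).
Proof.
move=> aO [c [cO ->]]; exists (fun i => a * c i); split=> [i|].
  by rewrite rpredM.
by rewrite scaler_sumr; apply: eq_bigr => i _; rewrite scalerA.
Qed.

Lemma OspanB (V : vectType E) (s : seq V) u v : in_Ospan s u -> in_Ospan s v ->
  in_Ospan s (u - v).
Proof.
move=> us vs; rewrite -scaleN1r; apply: OspanD => //; apply: OspanZ => //.
by rewrite rpredN rpred1.
Qed.

Lemma Ospan_sum (V : vectType E) (s : seq V) (I : finType) (F : I -> V) :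
  (forall i, in_Ospan s (F i)) -> in_Ospan s (\sum_i F i).
Proof.
move=> h; apply: (big_ind (in_Ospan s)) => //; last exact: OspanD.
exists (fun=> 0); split=> [i|]; rewrite ?rpred0 //.
by rewrite big1 // => i _; rewrite scale0r.
Qed.

Lemma Ospan_mem (V : vectType E) (s : seq V) v : v \in s -> in_Ospan s v.
Proof.
move=> vs; apply/(Ospan_tupleP (in_tuple s)).
have vi : (index v s < size s)%N by rewrite index_mem.
exists (fun i => (i == Ordinal vi)%:R); first by move=> i; rewrite rpred_nat.
rewrite (bigD1 (Ordinal vi)) //= eqxx scale1r big1 ?addr0; last first.
  by move=> i /negPf->; rewrite scale0r.
by rewrite (tnth_nth 0) /= nth_index.
Qed.

Lemma Ospan_span (V : vectType E) (s : seq V) v : in_Ospan s v -> v \in <<s>>%VS.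
Proof.
case=> c [_ ->]; apply: memv_suml => i _; apply: memvZ; apply: memv_span.
by rewrite mem_nth.
Qed.

Lemma gram_combination (L : hermLattice) n (b : n.-tuple (hl_space L)) m
    (X : 'M[E]_(m, n)) (u : 'I_m -> hl_space L) :
  (forall i, u i = \sum_j X i j *: tnth b j) ->
  \matrix_(i, j) hl_form L (u i) (u j) = X *m gram b *m X ^t conjE.
Proof.
move=> eu; apply/matrixP => i j; rewrite !mxE !eu hform_sumr.
apply: eq_bigr => k _; rewrite hformZr !mxE hform_suml mulrC; congr (_ * _).
by apply: eq_bigr => l _; rewrite hformZl !mxE.
Qed.

Lemma coord_mx (V : vectType E) n (b : n.-tuple V) m (u : 'I_m -> V) :
  (forall i, in_Ospan b (u i)) ->
  exists2 X : 'M[E]_(m, n), X \is a mxOver OE & forall i, u i =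
    \sum_j X i j *: tnth b j.
Proof.
move=> h.
have /choice[f hf] i : exists c : 'I_n ->
  E, (forall j, c j \in OE) /\ u i = \sum_j c j *: tnth b j.
  by have /Ospan_tupleP[c cO e] := h i; exists c.
exists (\matrix_(i, j) f i j).
  by apply/mxOverP => i j; rewrite mxE; case: (hf i).
by move=> i; case: (hf i) => _ {1}->; apply: eq_bigr => j _; rewrite mxE.
Qed.

(** Representation is phrased through some bases of both lattices; changing
    basis on the source realizes any finite family of its vectors, with the same
    Gram matrix, inside [L]. *)
Lemma represents_transfer (L l : hermLattice) m (d : m.-tuple (hl_space l)) :
  represents L l -> (forall i, in_lattice (tnth d i)) ->
  exists u : 'I_m -> hl_space L, (forall i, in_lattice (u i)) /\
    \matrix_(i, j) hl_form L (u i) (u j) = gram d.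
Proof.
case=> n [b [k [c [X [[_ bL] [_ cl] XO e]]]]] dl.
have [|Y YO eY] := @coord_mx _ _ c m (tnth d); first by move=> i; apply/cl.
exists (fun i => \sum_j (Y *m X) i j *: tnth b j); split.
  move=> i; apply/bL/Ospan_tupleP; exists ((Y *m X) i) => // j.
  by have /mxOverP := mxOverM YO XO; apply.
rewrite (@gram_combination L n b m (Y *m X)) // /gram -/(gram d).
rewrite [RHS](@gram_combination l k c m Y) // e.
by rewrite trmx_mul map_mxM !mulmxA.
Qed.

Lemma represents_vectors (L l : hermLattice) n (b : n.-tuple (hl_space L)) m
    (c : m.-tuple (hl_space l)) k (u : 'I_k -> hl_space L) :
  is_basis b -> is_basis c -> (forall i, in_lattice (u i)) ->
  mx_represented (gram c) (\matrix_(i, j) hl_form L (u i) (u j)) -> represents L l.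
Proof.
move=> bB cB uL [X XO e].
have [|W WO eW] := @coord_mx _ _ b k u; first by move=> i; apply/(bB.2).
exists n, b, m, c, (X *m W); split=> //; first exact: mxOverM.
by rewrite e (gram_combination eW) trmx_mul map_mxM !mulmxA.
Qed.

(** * A diagonal ternary sublattice *)

Lemma hformDl (L : hermLattice) u v w : hl_form L (u + v) w =
  hl_form L u w + hl_form L v w.
Proof. exact: linearDl. Qed.

Lemma hformBl (L : hermLattice) u v w : hl_form L (u - v) w =
  hl_form L u w - hl_form L v w.
Proof. exact: linearBl. Qed.

Lemma hformDr (L : hermLattice) u v w : hl_form L u (v + w) =
  hl_form L u v + hl_form L u w.
Proof. exact: linearDr. Qed.

Lemma hformBr (L : hermLattice) u v w : hl_form L u (v - w) =
  hl_form L u v - hl_form L u w.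
Proof. exact: linearBr. Qed.

Lemma hform0l (L : hermLattice) u : hl_form L 0 u = 0.
Proof. exact: linear0l. Qed.

Lemma lattice_norm (L : hermLattice) v : positive L -> in_lattice v ->
  exists k : int, [/\ hl_form L v v = k%:~R, 0 <= k & (k = 0 -> v = 0)].
Proof.
move=> pL vL; have eH : hl_form L v v = (toZ (hl_form L v v))%:~R.
  by apply: OE_real; [exact: hl_integral | rewrite -hformC].
exists (toZ (hl_form L v v)); split=> //.
  have [->|v0] := eqVneq v 0; first by rewrite hform0l (toZK 0).
  by have := pL _ vL v0; move: (toZ _) eH => k ->; rewrite val_intE ltr0z => /ltW.
move=> k0; apply/eqP; apply: contrapT => /negP v0.
by have := pL _ vL v0; rewrite eH k0 ltxx.
Qed.

(** An orthonormal pair splits off over the integers: no denominators occur in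
    the projection. *)
Lemma orthonormal_complement (L : hermLattice) (e1 e2 v : hl_space L)
    (w := v - hl_form L v e1 *: e1 - hl_form L v e2 *: e2) :
  in_lattice e1 -> in_lattice e2 -> in_lattice v ->
  hl_form L e1 e1 = 1 -> hl_form L e2 e2 = 1 -> hl_form L e1 e2 = 0 ->
  [/\ in_lattice w, hl_form L w e1 = 0, hl_form L w e2 = 0 &
   hl_form L v v = (normZ (hl_form L v e1))%:~R + (normZ (hl_form L v e2))%:~R + hl_form L w w].
Proof.
move=> L1 L2 Lv h1 h2 h12.
have h21 : hl_form L e2 e1 = 0 by rewrite hformC h12 rmorph0.
have O1 : hl_form L v e1 \in OE by exact: hl_integral.
have O2 : hl_form L v e2 \in OE by exact: hl_integral.
have w1 : hl_form L w e1 = 0.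
  by rewrite /w !hformBl !hformZl h1 h21; ring.
have w2 : hl_form L w e2 = 0.
  by rewrite /w !hformBl !hformZl h2 h12; ring.
split=> //; first by apply: OspanB; first apply: OspanB => //; exact: OspanZ.
have -> : hl_form L w w = hl_form L w v.
  by rewrite {2}/w !hformBr !hformZr w1 w2 !mulr0 !subr0.
rewrite /w !hformBl !hformZl !normZE // -!hformC; ring.
Qed.

(** From m ^ 2 + m n + n ^ 2 = 2 one gets m ^ 2 + n ^ 2 + (m + n) ^ 2 = 4, so m
    and n lie between -2 and 2. *)
Lemma normZ_neq2 x : x \in OE -> normZ x <> 2.
Proof.
case/OEP=> m [n ->]; rewrite normZ_coord => h.
have hm : m ^+ 2 <= 4 by have := sqr_ge0 (m + n); have := sqr_ge0 n; lia.
have hn : n ^+ 2 <= 4 by have := sqr_ge0 (m + n); have := sqr_ge0 m; lia.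
have bnd (k : int) : k ^+ 2 <= 4 -> k = -2 \/ k = -1 \/ k = 0 \/ k = 1 \/ k = 2.
  by move=> hk; have : -2 <= k <= 2 by [nia]; lia.
by move: h; case: (bnd m hm) => [|[|[|[|]]]] ->;
  case: (bnd n hn) => [|[|[|[|]]]] ->.
Qed.

(** The component of [w] orthogonal to the pair has norm 2 - N(s) where s is the
    e2-coordinate of [w]; as 2 is not a norm, this is 1 or 2. *)
Lemma complete_orthonormal_pair (L : hermLattice) (e1 e2 w : hl_space L) :
  positive L -> in_lattice e1 -> in_lattice e2 -> in_lattice w ->
  hl_form L e1 e1 = 1 -> hl_form L e2 e2 = 1 -> hl_form L e1 e2 = 0 ->
  hl_form L w w = 2 -> hl_form L w e1 = 0 ->
  exists f (D : int), [/\ in_lattice f, hl_form L f e1 = 0, hl_form L f e2 = 0,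
    hl_form L f f = D%:~R & 0 < D <= 2].
Proof.
move=> pL L1 L2 Lw h1 h2 h12 hw hw1.
have := @orthonormal_complement L e1 e2 w L1 L2 Lw h1 h2 h12.
set f := w - _ - _ => -[Lf f1 f2 e].
have [k [ek k0 _]] := lattice_norm pL Lf.
exists f, k; split=> //.
have O2 : hl_form L w e2 \in OE by exact: hl_integral.
have {}e : normZ (hl_form L w e2) + k = 2.
  apply: intE_inj; rewrite rmorphD /= -ek -[RHS]hw e hw1 (normZ_int 0); ring.
have := normZ_neq2 O2; have := normZ_ge0 O2; lia.
Qed.

(** If the norm 1 vector v is not in the span of e1 and e2, its orthogonal
    component has norm 1. Otherwise v is a unit multiple of e1 or of e2, so w is
    orthogonal to that vector too, and its orthogonal component completes the
    pair. *)
Lemma orthogonal_triple (L : hermLattice) : positive L ->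
  represents L (diag_lattice [:: 1; 1]) -> represents L (diag_lattice [:: 1; 2]) ->
  exists (u : 'I_3 -> hl_space L) (D : int), [/\ forall i, in_lattice (u i),
    0 < D <= 2 &
    \matrix_(i, j) hl_form L (u i) (u j) = herm3 1 1 D 0 0 0].
Proof.
move=> pL R11 R12.
have std a i : in_lattice (tnth (diag_basis a) i).
  by apply: Ospan_mem; rewrite mem_tnth.
have [e [Le ge]] := represents_transfer R11 (std _).
have [v [Lv gv]] := represents_transfer R12 (std _).
rewrite gram_diag_basis in ge; rewrite gram_diag_basis in gv.
have {ge} ge i j := congr1 (fun M : 'M_ _ => M i j) ge.
have {gv} gv i j := congr1 (fun M : 'M_ _ => M i j) gv.
have e00 := ge ord0 ord0; have e11 := ge ord_max ord_max.
have e01 := ge ord0 ord_max.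
have v00 := gv ord0 ord0; have v11 := gv ord_max ord_max.
have v01 := gv ord_max ord0.
rewrite !mxE /= in e00 e11 e01 v00 v11 v01.
move: (Le ord0) (Le ord_max) (Lv ord0) (Lv ord_max) e00 e11 e01 v00 v11 v01.
move: (e ord0) (e ord_max) (v ord0) (v ord_max) => {e Le ge v Lv gv std} e1 e2 v w.
rewrite !mulr1n !mulr0n => L1 L2 Lv Lw h1 h2 h12 hv hw hwv.
have final f g h (D : int) : in_lattice f -> in_lattice g -> in_lattice h ->
  0 < D <= 2 ->
  hl_form L f f = 1 -> hl_form L g g = 1 -> hl_form L f g = 0 ->
    hl_form L h f = 0 ->
  hl_form L h g = 0 -> hl_form L h h = D%:~R ->
  exists (u : 'I_3 -> hl_space L) (D : int), [/\ forall i, in_lattice (u i),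
    0 < D <= 2 &
    \matrix_(i, j) hl_form L (u i) (u j) = herm3 1 1 D 0 0 0].
  move=> Lf Lg Lh D2 ff gg fg hf hg hh.
  exists (tnth [tuple f; g; h]), D; split=> //.
    by move=> [[|[|[|i]]] hi].
  have gf : hl_form L g f = 0 by rewrite hformC fg rmorph0.
  have fh : hl_form L f h = 0 by rewrite hformC hf rmorph0.
  have gh : hl_form L g h = 0 by rewrite hformC hg rmorph0.
  apply/matrixP => -[[|[|[|i]]] hi] -[[|[|[|j]]] hj] //;
    by rewrite !mxE /= !(tnth_nth 0) /= ?ff ?gg ?hh ?fg ?hf ?hg ?gf ?fh ?gh ?rmorph0.
have [] := @orthonormal_complement L e1 e2 v L1 L2 Lv h1 h2 h12.
set f := v - _ - _ => Lf f1 f2 ev.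
have [k [ek k0 kz]] := lattice_norm pL Lf.
have O1 : hl_form L v e1 \in OE by exact: hl_integral.
have O2 : hl_form L v e2 \in OE by exact: hl_integral.
have {}ev : normZ (hl_form L v e1) + normZ (hl_form L v e2) + k = 1.
  by apply: intE_inj; rewrite -[RHS]hv ev ek; ring.
have n1 := normZ_ge0 O1; have n2 := normZ_ge0 O2.
have [k1|k1] := eqVneq k 1.
  by apply: (@final e1 e2 f k) => //; lia.
have {kz} fz : f = 0 by apply: kz; lia.
have {fz} ev2 : v = hl_form L v e1 *: e1 + hl_form L v e2 *: e2.
  by apply/eqP; rewrite -subr_eq0 opprD addrA -/f fz.
have orth x (g : hl_space L) : v = x *: g -> x != 0 -> hl_form L w g = 0.
  move=> vx x0; move: hwv; rewrite vx hformZr => /eqP.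
  by rewrite mulf_eq0 fmorph_eq0 (negPf x0) => /eqP.
have h21 : hl_form L e2 e1 = 0 by rewrite hformC h12 rmorph0.
have nz x : normZ x = 1 -> x != 0 by apply: contra_eq_neq => ->;
  rewrite (normZ_int 0).
have [y0|y0] := eqVneq (normZ (hl_form L v e2)) 0.
  have we1 : hl_form L w e1 = 0.
    apply: (orth (hl_form L v e1)); last by apply: nz; lia.
    by rewrite {1}ev2 (normZ_eq0 O2 y0) scale0r addr0.
  have [g [D [Lg g1 g2 gg D2]]] :=
    complete_orthonormal_pair pL L1 L2 Lw h1 h2 h12 hw we1.
  exact: (@final e1 e2 g D).
have x0 : normZ (hl_form L v e1) = 0 by lia.
have we2 : hl_form L w e2 = 0.
  apply: (orth (hl_form L v e2)); last by apply: nz; lia.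
  by rewrite {1}ev2 (normZ_eq0 O1 x0) scale0r add0r.
have [g [D [Lg g2 g1 gg D2]]] :=
  complete_orthonormal_pair pL L2 L1 Lw h2 h1 h21 hw we2.
exact: (@final e2 e1 g D).
Qed.

(** * Bases of binary lattices *)

Lemma Qsqrtm3_frac (x : E) : exists2 k : int, 0 < k & k%:~R * x \in OE.
Proof.
have /in_Qsqrtm3P[a [b e]] := Qsqrtm3_valP x.
exists (denq a * denq b); first by rewrite mulr_gt0 ?denq_gt0.
apply/OEP; exists (numq a * denq b - numq b * denq a), (2 * numq b * denq a).
apply: val_inj; rewrite /= !val_intE e.
have ratrK (r : rat) : ratr r * (denq r)%:~R = (numq r)%:~R :> algC.
  by rewrite /ratr divfK // intr_eq0 denq_neq0.
transitivity ((ratr a * (denq a)%:~R) * (denq b)%:~R +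
   (ratr b * (denq b)%:~R) * (denq a)%:~R * sqrtC (-3) : algC); first by ring.
by rewrite !ratrK; field.
Qed.

Lemma Qsqrtm3_near (x : E) : exists q r (k : int),
  [/\ q \in OE, r \in OE, 0 < k, k%:~R * (x - q) = r & 3 * normZ r <= k ^+ 2].
Proof.
have [k k0 kx] := Qsqrtm3_frac x.
have [q qO h] := OE_div_int k0 kx.
exists q, (k%:~R * x - k%:~R * q), k; split=> //; last by ring.
by rewrite rpredB // rpredM ?rpred_int.
Qed.

Definition gram_det (L : hermLattice) (u v : hl_space L) : E :=
  hl_form L u u * hl_form L v v - hl_form L u v * hl_form L v u.

Lemma gram_detC (L : hermLattice) (u v : hl_space L) : gram_det u v = gram_det v u.
Proof. by rewrite /gram_det; ring. Qed.

Lemma gram_det0 (L : hermLattice) (u : hl_space L) : gram_det u 0 = 0.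
Proof. by rewrite /gram_det [hl_form L u 0]hformC !hform0l rmorph0 !mulr0 subr0. Qed.

Lemma gram_det_combine (L : hermLattice) (u v : hl_space L) x y :
  gram_det u (x *: u + y *: v) = y * conjE y * gram_det u v.
Proof.
rewrite /gram_det !(hformDl, hformDr, hformZl, hformZr); ring.
Qed.

Lemma gram_det_int (L : hermLattice) (u v : hl_space L) :
  in_lattice u -> in_lattice v -> gram_det u v = (toZ (gram_det u v))%:~R.
Proof.
move=> uL vL; apply: OE_real.
  by rewrite rpredB // rpredM //; exact: hl_integral.
rewrite /gram_det !(rmorphB, rmorphM) /= -!hformC; ring.
Qed.

(** The last condition asks for coordinates in the field only; [d > 0] makes the
    pair independent. *)
Definition lattice_pair (L : hermLattice) (u v : hl_space L) (d : int) :=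
  [/\ in_lattice u, in_lattice v, gram_det u v = d%:~R, 0 < d &
      forall w : hl_space L, in_lattice w -> exists x y, w = x *: u + y *: v].

Lemma lattice_pairC (L : hermLattice) (u v : hl_space L) d :
  lattice_pair u v d -> lattice_pair v u d.
Proof.
case=> uL vL ed d0 sp; split=> //; first by rewrite gram_detC.
by move=> w /sp[x [y ->]]; exists y, x; rewrite addrC.
Qed.

(** A lattice vector w with a non-integral coordinate y on v yields, after
    subtracting the integer nearest to y, a vector that can replace v; the Gram
    determinant gets multiplied by the norm of the remainder, which is at most
    1/3. *)
Lemma lattice_pair_shrink (L : hermLattice) (u v w : hl_space L) d x y :
  lattice_pair u v d -> in_lattice w -> w = x *: u + y *: v -> y \notin OE ->
  exists v' d', lattice_pair u v' d' /\ d' < d.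
Proof.
case=> uL vL ed d0 sp wL ew yO.
have [q [r [k [qO rO k0 ek hr]]]] := Qsqrtm3_near y.
have yq0 : y - q != 0 by apply: contraNneq yO => /eqP; rewrite subr_eq0 => /eqP ->.
pose v' := w - q *: v.
have ev' : v' = x *: u + (y - q) *: v by rewrite /v' ew scalerBl addrA.
have v'L : in_lattice v' by apply: OspanB => //; exact: OspanZ.
have ed' := gram_det_int uL v'L; set d' := toZ _ in ed'.
have e : k ^+ 2 * d' = normZ r * d.
  apply: intE_inj; rewrite !rmorphM /= -ed' ev' gram_det_combine ed normZE // -ek.
  by rewrite rmorphM /= rmorph_int; ring.
have kE : k%:~R != 0 :> E by rewrite intE_eq0; lia.
have r0 : 0 < normZ r.
  rewrite lt_neqAle normZ_ge0 // andbT eq_sym; apply/eqP => /(normZ_eq0 rO) r0.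
  by move: ek; rewrite r0 => /eqP; rewrite mulf_eq0 (negPf kE) (negPf yq0).
have k2 : 0 < k ^+ 2 by rewrite exprn_gt0.
exists v', d'; split; last first.
  rewrite -(ltr_pM2l k2) e ltr_pM2r //; lia.
split=> //.
  by rewrite -(pmulr_rgt0 _ k2) e mulr_gt0.
move=> z /sp[s [t ->]]; exists (s - t / (y - q) * x), (t / (y - q)).
by rewrite ev' scalerDr !scalerA divfK // addrA -scalerDl subrK.
Qed.

(** By the shrinking lemma, a pair of least Gram determinant has integral
    coordinates for every lattice vector. *)
Lemma lattice_pair_basis (L : hermLattice) (u v : hl_space L) d :
  lattice_pair u v d ->
  exists (u' v' : hl_space L) d', lattice_pair u' v' d' /\ is_basis [tuple u'; v'].
Proof.
have [n] := ubnP (absz d); elim: n u v d => // n IH u v d dn pr.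
have d0 : 0 < d by case: pr.
have shrink (u' v' w : hl_space L) x y : lattice_pair u' v' d -> in_lattice w ->
    w = x *: u' + y *: v' -> y \notin OE ->
    exists (u2 v2 : hl_space L) d', lattice_pair u2 v2 d' /\
      is_basis [tuple u2; v2].
  move=> pr' wL ew yO; have [v2 [d' [pr2 dd]]] := lattice_pair_shrink pr' wL ew yO.
  by have d'0 : 0 < d' by [case: pr2]; apply: (IH _ _ d' _ pr2); lia.
have [all_in|] := pselect (forall w x y, in_lattice w -> w = x *: u + y *: v ->
   x \in OE /\ y \in OE); last first.
  move/existsNP => [w /existsNP[x /existsNP[y /not_implyP[wL /not_implyP[ew h]]]]].
  have [yO|yO] := boolP (y \in OE); last exact: shrink pr wL ew yO.
  have [xO|xO] := boolP (x \in OE); first by case: h.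
  by apply: (shrink v u w y x (lattice_pairC pr) wL _ xO); rewrite ew addrC.
exists u, v, d; split=> //; case: pr => uL vL ed _ sp; split.
  apply/freeP => k; rewrite !big_ord_recl big_ord0 /= addr0 => e.
  have dE : gram_det u v != 0 by rewrite ed intE_eq0; lia.
  have k1 : k (lift ord0 ord0) = 0.
    have := gram_det_combine u v (k ord0) (k (lift ord0 ord0)).
    rewrite e gram_det0.
    move/esym/eqP; rewrite !mulf_eq0 fmorph_eq0 orbb (negPf dE) orbF.
    by move/eqP.
  have k0 : k ord0 = 0.
    have := gram_det_combine v u (k (lift ord0 ord0)) (k ord0).
    rewrite addrC e gram_det0 gram_detC.
    move/esym/eqP; rewrite !mulf_eq0 fmorph_eq0 orbb (negPf dE) orbF.
    by move/eqP.
  by move=> [[|[|i]] hi] //; [rewrite -[RHS]k0 | rewrite -[RHS]k1]; congr (k _);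
    apply: val_inj.
move=> w; split=> [wL|/Ospan_tupleP[c cO ->]]; last first.
  by apply: Ospan_sum => i; apply: OspanZ => //; case: i => [[|[|i]] hi].
have [x [y ew]] := sp w wL; have [xO yO] := all_in w x y wL ew.
apply/Ospan_tupleP; exists (fun i : 'I_2 => if i == ord0 then x else y).
  by move=> i; case: ifP.
by rewrite !big_ord_recl big_ord0 /= addr0 ew.
Qed.

(** Two independent generators will do. Their Gram determinant is positive
    because its product with H(u, u) is the norm of the nonzero lattice vector
    H(u, u) v - H(v, u) u, a multiple of the component of v orthogonal to u. *)
Lemma binary_lattice_pair (L : hermLattice) : positive L -> rank L = 2%N ->
  exists (u v : hl_space L) d, lattice_pair u v d.
Proof.
move=> pL rk.
have ex_gen (u : hl_space L) : exists2 g, g \in hl_gens L & g \notin <[u]>%VS.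
  apply: contrapT => h.
  have : (<<hl_gens L>> <= <[u]>)%VS.
    apply/span_subvP => g gL; apply: contrapT => /negP gu; apply: h; by exists g.
  by move/dimvS; rewrite -/(rank L) rk dim_vline; case: (u != 0).
have [u uG u0] := ex_gen 0; have [v vG vu] := ex_gen u.
have {}u0 : u != 0 by apply: contraNneq u0 => ->; exact: mem0v.
have uL : in_lattice u by exact: Ospan_mem.
have vL : in_lattice v by exact: Ospan_mem.
have [a [ea a0 az]] := lattice_norm pL uL.
have {az} a0 : 0 < a.
  by rewrite lt_neqAle a0 andbT eq_sym; apply: contraNneq u0 => /az ->.
have ed := gram_det_int uL vL; set d := toZ _ in ed.
exists u, v, d; split=> //.
  have O1 : hl_form L v u \in OE by exact: hl_integral.
  pose w := a%:~R *: v - hl_form L v u *: u.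
  have wL : in_lattice w by apply: OspanB; apply: OspanZ; rewrite ?rpred_int.
  have w0 : w != 0.
    rewrite /w subr_eq0; apply: contra vu => /eqP e; apply/vlineP.
    exists (a%:~R^-1 * hl_form L v u);
      rewrite -scalerA -e scalerA mulVf ?scale1r //.
    by rewrite intE_eq0; lia.
  have [k [ek k0 kz]] := lattice_norm pL wL.
  have {kz} k0 : 0 < k.
    by rewrite lt_neqAle k0 andbT eq_sym; apply: contraNneq w0 => /kz ->.
  have e : k = a * d.
    apply: intE_inj; rewrite -ek rmorphM /= -ed /gram_det.
    rewrite /w !(hformBl, hformBr, hformZl, hformZr) rmorph_int ea -(hformC u v);
      ring.
  by rewrite -(pmulr_rgt0 _ a0) -e.
move=> w wL.
have fr : <<[:: v; u]>>%VS = <<hl_gens L>>%VS.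
  apply/eqP; rewrite eqEdim; apply/andP; split.
    by apply/span_subvP => g; rewrite !inE => /orP[]/eqP->; apply: memv_span.
  rewrite -/(rank L) rk; suff /eqP-> : free [:: v; u] by [].
  by rewrite free_cons span_seq1 vu free_cons span_nil memv0 u0 nil_free.
have : w \in <<[:: v; u]>>%VS by rewrite fr; exact: Ospan_span.
rewrite span_cons span_seq1 => /memv_addP[_ /vlineP[y ->] [_ /vlineP[x ->] ->]].
by exists x, y; rewrite addrC.
Qed.

(** * Two-universality *)

Theorem theorem10 (L : hermLattice) (posL : positive L)
  (L11 : represents L (diag_lattice [:: 1; 1]))
  (L12 : represents L (diag_lattice [:: 1; 2])) :
  two_universal L.
Proof.
split=> // l posl rkl.
have [u [D [uL /andP[D0 D2] gu]]] := orthogonal_triple posL L11 L12.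
have [n [b [_ [_ [_ [bB _ _ _]]]]]] := L11.
have [c1 [c2 [d0 pr0]]] := binary_lattice_pair posl rkl.
have [v [w [d [[vL wL ed dpos _] cB]]]] := lattice_pair_basis pr0.
apply: (represents_vectors bB cB uL); rewrite gu.
have [a [ea a0 az]] := lattice_norm posl vL.
have [c [ec _ _]] := lattice_norm posl wL.
have xO : hl_form l v w \in OE by exact: hl_integral.
have -> : gram [tuple v; w] = herm2 a c (hl_form l v w).
  apply/matrixP => -[[|[|i]] hi] -[[|[|j]] hj] //; rewrite !mxE !(tnth_nth 0) //=.
  exact: hformC.
have edet : a * c - normZ (hl_form l v w) = d.
  by apply: intE_inj; rewrite -ed rmorphB rmorphM /= normZE // -hformC -ea -ec.
apply: binary_represented => //; last by rewrite edet.
rewrite lt_neqAle a0 andbT eq_sym; apply/eqP => /az v0.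
by move: ed dpos; rewrite /gram_det v0 !hform0l !mul0r subr0 => /esym/eqP;
  rewrite intE_eq0 => /eqP->.
Qed.
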